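(* Let $K$ be any field, let $S=K[x_1,\dots,x_n]$, and let $G$ be a finite simple graph on the vertex set $[n]$ with edge ideal $I=I(G)\subset S$. Write $t_i=t_i(S/I)$. Then for all integers $0\leq b\leq 4$ and all integers $a\geq 0$ with $a+b\leq \mathrm{pd}_S(S/I)$, $$t_{a+b}\leq t_a+t_b.$$
   Context: $S=K[x_1,\dots,x_n]$ is standard graded ($\deg(x_i)=1$). For a finite simple graph $G$ on $[n]=\{1,\dots,n\}$ with edge set $E(G)$, the edge ideal is $I(G)=\langle x_ix_j : \{i,j\}\in E(G)\rangle\subset S$. The graded Betti numbers are $\beta_{i,j}(S/I)=\dim_K \mathrm{Tor}_i^S(S/I,K)_j$; $\mathrm{pd}_S(S/I)$ is the projective dimension of $S/I$; and for $0\le i\le \mathrm{pd}_S(S/I)$, $t_i(S/I)=\max\{j : \beta_{i,j}(S/I)\neq 0\}$ is the maximal shift in homological degree $i$ of the minimal graded free $S$-resolution of $S/I$. *)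

(* Defs.v *)
From HB Require Import structures.
From mathcomp Require Import all_boot all_order all_algebra.
From mathcomp Require Import ring_quotient.
From mathcomp Require boolp.
From mathcomp Require Import mpoly.

Set Implicit Arguments.
Unset Strict Implicit.
Unset Printing Implicit Defensive.

Import GRing.Theory.
Local Open Scope ring_scope.
Local Open Scope quotient_scope.

Definition edge_ideal (K : fieldType) (n : nat) (e : rel 'I_n)
    (f : {mpoly K[n]}) : Prop :=
  exists c : 'I_n -> 'I_n -> {mpoly K[n]},
    f = \sum_(i < n) \sum_(j < n | e i j) c i j * ('X_i * 'X_j).

Definition edge_idealb (K : fieldType) (n : nat) (e : rel 'I_n) :
    {pred {mpoly K[n]}} :=
  fun f => boolp.asbool (edge_ideal e f).
Arguments edge_idealb K {n} e.

Lemma edge_idealP (K : fieldType) (n : nat) (e : rel 'I_n) (f : {mpoly K[n]}) :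
  reflect (edge_ideal e f) (f \in edge_idealb K e).
Proof. exact: boolp.asboolP. Qed.

Lemma edge_idealb_mul (K : fieldType) (n : nat) (e : rel 'I_n)
    (a f : {mpoly K[n]}) :
  f \in edge_idealb K e -> a * f \in edge_idealb K e.
Proof.
move=> /edge_idealP [c ->]; apply/edge_idealP.
exists (fun i j => a * c i j); rewrite mulr_sumr; apply: eq_bigr => i _.
by rewrite mulr_sumr; apply: eq_bigr => j _; rewrite mulrA.
Qed.

Lemma edge_idealb_zmod (K : fieldType) (n : nat) (e : rel 'I_n) :
  zmod_closed (edge_idealb K e).
Proof.
split.
  apply/edge_idealP; exists (fun _ _ => 0); symmetry.
  by apply: big1 => i _; apply: big1 => j _; rewrite mul0r.
move=> f g /edge_idealP [c ->] /edge_idealP [d ->]; apply/edge_idealP.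
exists (fun i j => c i j - d i j); rewrite -sumrB; apply: eq_bigr => i _.
by rewrite -sumrB; apply: eq_bigr => j _; rewrite mulrBl.
Qed.

HB.instance Definition _ (K : fieldType) (n : nat) (e : rel 'I_n) :=
  GRing.isZmodClosed.Build _ (edge_idealb K e) (edge_idealb_zmod K e).

(* S/I(G) as a module over S = {mpoly K[n]}; the library's quotient by an
   ideal only comes with a ring structure. *)

Definition edge_ring (K : fieldType) (n : nat) (e : rel 'I_n) : Type :=
  {ideal_quot edge_idealb K e}.

HB.instance Definition _ (K : fieldType) (n : nat) (e : rel 'I_n) :=
  GRing.Zmodule.on (edge_ring K e).

Definition edge_proj (K : fieldType) (n : nat) (e : rel 'I_n)
    (f : {mpoly K[n]}) : edge_ring K e :=
  \pi_{ideal_quot edge_idealb K e} f.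

Section EdgeRingModule.
Variables (K : fieldType) (n : nat) (e : rel 'I_n).
Local Notation S := {mpoly K[n]}.
Local Notation Q := (edge_ring K e).
Local Notation proj := (@edge_proj K n e).

Definition edge_scale (a : S) (x : Q) : Q :=
  proj (a * repr (x : {ideal_quot edge_idealb K e})).

Lemma edge_projP (f g : S) : proj f = proj g <-> edge_ideal e (f - g).
Proof.
split=> [h|h]; first by apply/edge_idealP; rewrite Quotient.idealrBE; apply/eqP.
by apply/eqP; rewrite /edge_proj -Quotient.idealrBE; apply/edge_idealP.
Qed.

Lemma edge_projD (f g : S) : proj (f + g) = proj f + proj g.
Proof. exact: (raddfD \pi_{ideal_quot edge_idealb K e}). Qed.

Lemma edge_projK (x : Q) : proj (repr (x : {ideal_quot edge_idealb K e})) = x.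
Proof. exact: reprK. Qed.

Lemma edge_scaleE (a f : S) : edge_scale a (proj f) = proj (a * f).
Proof.
apply/edge_projP; rewrite -mulrBr; apply/edge_idealP/edge_idealb_mul.
by apply/edge_idealP/edge_projP; rewrite edge_projK.
Qed.

Lemma edge_scaleA (a b : S) (x : Q) :
  edge_scale a (edge_scale b x) = edge_scale (a * b) x.
Proof. by rewrite -(edge_projK x) !edge_scaleE mulrA. Qed.

Lemma edge_scale1 : left_id 1 edge_scale.
Proof. by move=> x; rewrite -(edge_projK x) edge_scaleE mul1r. Qed.

Lemma edge_scaleDr : right_distributive edge_scale +%R.
Proof.
move=> a x y; rewrite -(edge_projK x) -(edge_projK y).
by rewrite -edge_projD !edge_scaleE -edge_projD mulrDr.
Qed.

Lemma edge_scaleDl (x : Q) :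
  {morph edge_scale^~ x : a b / a + b >-> a + b}.
Proof.
by move=> a b; rewrite -(edge_projK x) !edge_scaleE -edge_projD mulrDl.
Qed.

HB.instance Definition _ := GRing.Zmodule_isLmodule.Build S Q
  edge_scaleA edge_scale1 edge_scaleDr edge_scaleDl.

End EdgeRingModule.

Definition projective (R : pzRingType) (P : lmodType R) : Prop :=
  forall (A B : lmodType R) (g : {linear A -> B}) (f : {linear P -> B}),
    (forall y : B, exists x : A, g x = y) ->
    exists h : {linear P -> A}, forall x : P, g (h x) = f x.

Definition proj_res_le (R : pzRingType) (M : lmodType R) (d : nat) : Prop :=
  exists (P : nat -> lmodType R)
         (del : forall i : nat, {linear P i.+1 -> P i})
         (eps : {linear P 0%N -> M}),
    [/\ forall i, projective (P i),
        forall i, (d < i)%N -> forall x : P i, x = 0,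
        forall y : M, exists x, eps x = y,
        forall x, eps x = 0 <-> exists y, del 0%N y = x
      & forall i x, del i x = 0 <-> exists y, del i.+1 y = x].

Definition is_proj_dim (R : pzRingType) (M : lmodType R) (p : nat) : Prop :=
  proj_res_le M p /\ forall d : nat, proj_res_le M d -> (p <= d)%N.

(* A graded free resolution of S/I(G): F_i = \bigoplus_k S(- gshift i k) has
   [grank i] generators and its elements are row vectors; the differential
   F_(i+1) -> F_i is v |-> v *m gdiff i.  The augmentation F_0 -> S/I(G) sends
   the k-th generator to the class of [gaug k 0].  Minimality is not required:
   Tor can be computed from any of them. *)
Record graded_free_res (K : fieldType) (n : nat) (e : rel 'I_n) : Type :=
  GradedFreeRes {
    grank : nat -> nat;
    gshift : forall i : nat, 'I_(grank i) -> nat;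
    gdiff : forall i : nat, 'M[{mpoly K[n]}]_(grank i.+1, grank i);
    gaug : 'cV[{mpoly K[n]}]_(grank 0);
    gdiff_homog : forall i k l m, m \in msupp (gdiff i k l) ->
      (mdeg m + gshift l = gshift k)%N;
    gaug_homog : forall k m, m \in msupp (gaug k 0) -> mdeg m = gshift k;
    gaug_onto : forall x : edge_ring K e,
      exists v : 'rV_(grank 0), edge_proj e ((v *m gaug) 0 0) = x;
    gaug_exact : forall v : 'rV_(grank 0),
      edge_proj e ((v *m gaug) 0 0) = 0 <-> exists w, w *m gdiff 0 = v;
    gdiff_exact : forall i (v : 'rV_(grank i.+1)),
      v *m gdiff i = 0 <-> exists w, w *m gdiff i.+1 = v
  }.

Section Betti.
Variables (K : fieldType) (n : nat) (e : rel 'I_n) (F : graded_free_res K e).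

(* The differential of F \otimes_S K, where K = S/(x_1, ..., x_n): only the
   constant coefficients of the entries survive. *)
Definition tor_diff (i : nat) : 'M[K]_(grank F i.+1, grank F i) :=
  map_mx (mcoeff 0%MM) (gdiff F i).

(* The row space of [tor_deg i j] is (F_i \otimes_S K)_j. *)
Definition tor_deg (i j : nat) : 'M[K]_(grank F i) :=
  diag_mx (\row_k (gshift (g := F) (i := i) k == j)%:R).

Definition tor_cycles (i j : nat) : 'M[K]_(grank F i) :=
  match i return 'M[K]_(grank F i) with
  | 0%N => tor_deg 0 j
  | i'.+1 => (tor_deg i'.+1 j :&: kermx (tor_diff i'))%MS
  end.

Definition tor_boundaries (i j : nat) : 'M[K]_(grank F i.+1, grank F i) :=
  tor_deg i.+1 j *m tor_diff i.

(* \dim_K Tor_i^S(S/I(G), K)_j = \dim_K H_i(F \otimes_S K)_j *)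
Definition betti (i j : nat) : nat :=
  \rank (tor_cycles i j) - \rank (tor_boundaries i j).

(* \max {j | betti i j != 0}: only the shifts of F_i can contribute, see
   [max_shift_ub] and [max_shift_betti]. *)
Definition max_shift (i : nat) : nat :=
  \max_(k < grank F i | betti i (gshift k) != 0%N) gshift k.

Lemma betti_gshift (i j : nat) :
  betti i j != 0%N -> exists k : 'I_(grank F i), gshift k = j.
Proof.
move=> bij; suff /existsP [k /eqP <-] : [exists k : 'I_(grank F i), gshift k == j].
  by exists k.
apply: contraNT bij => /existsPn hk.
have z : tor_deg i j = 0.
  by apply/matrixP=> k l; rewrite !mxE (negbTE (hk _)) mul0rn.
rewrite /betti subn_eq0 (_ : \rank (tor_cycles i j) = 0%N) //.
apply/eqP; rewrite -leqn0 -[leqRHS](mxrank0 K (grank F i) (grank F i)) -z.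
by rewrite mxrankS //; case: (i) => [|i'] //=; rewrite ?capmxSl.
Qed.

Lemma max_shift_ub (i j : nat) : betti i j != 0%N -> (j <= max_shift i)%N.
Proof.
move=> bij; have [k kj] := betti_gshift bij; rewrite -kj /max_shift.
by rewrite (bigD1 k) ?kj // leq_maxl.
Qed.

Lemma max_shift_betti (i j : nat) :
  betti i j != 0%N -> betti i (max_shift i) != 0%N.
Proof.
move=> bij; have [k kj] := betti_gshift bij.
have card0 : (0 < #|[pred k : 'I_(grank F i) | betti i (gshift k) != 0]|)%N.
  by apply/card_gt0P; exists k; rewrite inE kj.
by have [l bl ml] := eq_bigmax_cond (fun k => gshift k) card0;
   rewrite /max_shift ml.
Qed.

End Betti.

(* Main.v *)
Require Import Defs.
From mathcomp Require Import all_boot all_order all_algebra.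
From mathcomp Require boolp.
From mathcomp Require Import mpoly zify.

Set Implicit Arguments.
Unset Strict Implicit.
Unset Printing Implicit Defensive.

Import GRing.Theory.
Local Open Scope ring_scope.

(** Let [D] be the independence complex of the graph.  For a set [s] of vertices
write [H(s, h)] for the reduced cohomology of [D] restricted to [s] in degree
[h - 1], that is, on faces with [h] vertices.  Hochster's formula says that
[betti F i j <> 0] exactly when [H(s, j - i) <> 0] for some [s] with [j]
vertices ([bettiP]).  So with [j = i + h] the theorem becomes a statement on
induced subgraphs: if [H(s, h) <> 0] and [s] has [a + b + h] vertices, then [s]
contains two sets, one of homological degree [a] and one of homological degree
[b], whose values of [h] add up to at least [h] ([nonvan_subadd4]).

The topological tool is the Mayer-Vietoris sequence of the cover of [D|s] by
[D|(s - A)] and [D|(s - B)], where every vertex of [A] is adjacent to every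
vertex of [B]; the intersection of the two pieces is [D|(s - A - B)].  With an
edge it lowers the homological degree by one and [h] by at most one.  With the
star of a vertex of degree at least [b] it lowers the homological degree by [b]
and [h] by at most one.

Let [k] be the largest value of [h] found in homological degree [b] inside [s].
One must reach degree [a] losing at most [k].  If [k = b], remove [b] edges.  A
vertex of degree at least 2 gives two homological degrees for one unit of [h],
and a graph without such a vertex is a matching, for which [k = b]; this settles
[k >= b / 2].  There remain [b = 3] or [4] with [k = 1], where [b] degrees must
cost one unit.  Then [s] contains no induced pair of disjoint edges, unless [h]
is at most 2, which is trivial ([matching_grow] for [b = 3], [gap_absurd] for
[b = 4]).  In a graph without such a pair, either some vertex has degree at
least [b] and its star is the required step, or the degrees are bounded and the
link of a vertex is so small that some vertex can be deleted at no cost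
([gapfree_reach]).

Hochster's formula is proved by computing Tor in two ways.  The double complex
formed from the given resolution and the Koszul complex of the variables has
exact rows and columns, so the homology of [F] modulo the variables vanishes
exactly when the Koszul homology of [S/I] does ([zigzag], [tor_balanced]).  The
Koszul complex of [S/I] splits into multidegrees; the part of multidegree [a] is
a cone when [a] is not squarefree and is the cochain complex of [D|s] when [a]
is the indicator of [s]. *)

(** * Cochains on families of finite sets *)

(** The terms are paired off rather than shown equal to their opposites, so that
the sum vanishes in characteristic 2 as well. *)
Lemma sum_antisym (V : zmodType) (n : nat) (P : rel 'I_n)
    (F : 'I_n -> 'I_n -> V) :
  (forall u w, P u w -> [/\ P w u, u != w & F u w = - F w u]) ->
  \sum_u \sum_(w | P u w) F u w = 0.
Proof.
move=> PF.
rewrite (eq_bigr (fun u => \sum_(w | P u w && (u < w)%N) F u w +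
                           \sum_(w | P u w && ~~ (u < w)%N) F u w)); last first.
  by move=> u _; rewrite (bigID (fun w : 'I_n => (u < w)%N)).
rewrite big_split /=.
rewrite [X in _ + X](exchange_big_dep xpredT) //= -big_split /=.
apply: big1 => u _.
rewrite [X in _ + X](eq_big (fun w => P u w && (u < w)%N) (fun w => - F u w)).
- by rewrite sumrN subrr.
- move=> w; apply/andP/andP => [[/PF[Puw uw _]]|[/PF[Pwu uw _]]].
    by rewrite -leqNgt leq_eqVlt => /orP[/eqP/val_inj e|->//]; rewrite e eqxx in uw.
  by move=> lt; split=> //; rewrite -leqNgt ltnW.
- by move=> w /andP[/PF[_ _ ->]].
Qed.

Definition nbelow (n : nat) (u : 'I_n) (U : {set 'I_n}) : nat :=
  #|[set s in U | (s < u)%N]|.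

Lemma nbelow_setD1 (n : nat) (u w : 'I_n) (U : {set 'I_n}) :
  w \in U -> nbelow u U = ((w < u)%N + nbelow u (U :\ w))%N.
Proof.
move=> wU; rewrite /nbelow (cardsD1 w) !inE wU /=; congr (_ + #|pred_of_set _|)%N.
by apply/setP=> s; rewrite !inE andbA.
Qed.

Lemma sign_swap (R : pzRingType) (n : nat) (u w : 'I_n) (U : {set 'I_n}) :
  u \in U -> w \in U -> u != w ->
  (-1) ^+ nbelow u U * (-1) ^+ nbelow w (U :\ u)
    = - ((-1) ^+ nbelow w U * (-1) ^+ nbelow u (U :\ w)) :> R.
Proof.
move=> uU wU uw; rewrite -!exprD (nbelow_setD1 u wU) (nbelow_setD1 w uU).
have -> : (w < u)%N = ~~ (u < w)%N.
  by rewrite -leqNgt ltn_neqAle andb_idl // eq_sym.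
move: (nbelow _ _) (nbelow _ _) => a b.
by case: (u < w)%N; rewrite /= !add0n add1n addSn exprS mulN1r ?opprK addnC.
Qed.

Section Cochains.
Variables (K : fieldType) (n : nat).
Implicit Types (f g k : {set 'I_n} -> K) (U : {set 'I_n}).

Definition delta f U : K :=
  \sum_(u in U) (-1) ^+ nbelow u U * f (U :\ u).

Lemma deltaK f U : delta (delta f) U = 0.
Proof.
rewrite /delta (eq_bigr (fun u => \sum_(w in U :\ u) (-1) ^+ nbelow u U *
   ((-1) ^+ nbelow w (U :\ u) * f (U :\ u :\ w)))); last first.
  by move=> u _; rewrite mulr_sumr.
rewrite big_mkcond /=.
rewrite (eq_bigr (fun u => \sum_(w | [&& u \in U, w \in U & w != u])
  (-1) ^+ nbelow u U * ((-1) ^+ nbelow w (U :\ u) * f (U :\ u :\ w)))); last first.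
  move=> u _; case: (boolP (u \in U)) => uU /=; last by rewrite big_pred0.
  by apply: eq_bigl => w; rewrite !inE andbC.
apply: sum_antisym => u w /and3P[uU wU wu]; split; first by rewrite uU wU eq_sym.
  by rewrite eq_sym.
have -> : U :\ w :\ u = U :\ u :\ w by apply/setP=> s; rewrite !inE andbCA.
by rewrite !mulrA sign_swap 1?eq_sym // mulNr.
Qed.

Lemma eq_delta f g U :
  (forall u, u \in U -> f (U :\ u) = g (U :\ u)) -> delta f U = delta g U.
Proof. by move=> fg; apply: eq_bigr => u uU; rewrite fg. Qed.

Lemma deltaD f g U : delta (fun V => f V + g V) U = delta f U + delta g U.
Proof. by rewrite -big_split /=; apply: eq_bigr => u _; rewrite mulrDr. Qed.

Lemma deltaB f g U : delta (fun V => f V - g V) U = delta f U - delta g U.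
Proof. by rewrite -sumrB; apply: eq_bigr => u _; rewrite mulrBr. Qed.

(** The functions are defined on all sets: only their values on [P] matter, since
the families in use contain [U :\ u] along with [U]. *)
Definition acyclic (P : {pred {set 'I_n}}) (h : nat) : Prop :=
  forall f, (forall U, U \in P -> #|U| = h.+1 -> delta f U = 0) ->
  exists g, forall U, U \in P -> #|U| = h -> f U = delta g U.

Lemma eq_acyclic (P Q : {pred {set 'I_n}}) h :
  P =i Q -> acyclic P h -> acyclic Q h.
Proof.
move=> PQ aP f fQ; have [|g fg] := aP f; first by move=> U; rewrite PQ; apply: fQ.
by exists g => U; rewrite -PQ; apply: fg.
Qed.

(** The contracting homotopy adds the apex [t]. *)
Lemma acyclic_cone (P : {pred {set 'I_n}}) (t : 'I_n) (h : nat) :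
  (forall U, U \in P -> t |: U \in P) -> acyclic P h.
Proof.
move=> cone f f0.
exists (fun U => if t \in U then 0 else (-1) ^+ nbelow t (t |: U) * f (t |: U)).
move=> U UP Uh; rewrite /delta; case: (boolP (t \in U)) => tU.
  rewrite (bigD1 t) //= !inE eqxx /= setD1K // signrMK.
  rewrite big1 ?addr0 // => u /andP[uU ut].
  by rewrite !inE eq_sym ut tU mulr0.
have := f0 _ (cone _ UP); rewrite cardsU1 tU Uh => /(_ erefl).
rewrite /delta (bigD1 t) ?setU11 //= setU1K // => /eqP; rewrite addr_eq0 => /eqP fU.
apply: (can_inj (signrMK (nbelow t (t |: U)))); rewrite fU -sumrN mulr_sumr.
have sub u : u \in U -> (t |: U) :\ u = t |: (U :\ u) /\ (t |: U) :\ t = U.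
  move=> uU; split; last by rewrite setU1K.
  apply/setP=> s; rewrite !inE; case: (eqVneq s u) => //= ->.
  by rewrite orbF; apply/esym; apply: contraNF tU => /eqP <-.
rewrite (eq_bigl (mem U)); last first.
  move=> u /=; rewrite !inE; case: (eqVneq u t) => [->|] /=; last by rewrite andbT.
  by rewrite (negbTE tU).
apply: eq_bigr => u uU; have [tUu tUt] := sub u uU.
rewrite !inE (negbTE tU) andbF -tUu.
have := @sign_swap K n t u (t |: U) (setU11 _ _) (setU1r _ uU).
rewrite tUt => sw; rewrite [RHS]mulrA sw; last by apply: contraNneq tU => ->.
by rewrite mulNr -mulrA signrMK.
Qed.

End Cochains.

(** * Cohomology of induced subgraphs *)
Section IndependenceComplex.
Variables (K : fieldType) (n : nat) (e : rel 'I_n).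
Hypotheses (e_sym : ssrbool.symmetric e) (e_irr : irreflexive e).
Implicit Types (s t U A B : {set 'I_n}).

Definition indep : pred {set 'I_n} :=
  fun U => [forall x in U, forall y in U, ~~ e x y].

Definition faces s : {pred {set 'I_n}} := fun U => (U \subset s) && indep U.

Lemma indepP U : reflect {in U &, forall x y, ~~ e x y} (indep U).
Proof.
apply: (iffP forall_inP) => [h x y xU yU|h x xU].
  by have /forall_inP := h x xU; apply.
by apply/forall_inP=> y yU; apply: h.
Qed.

Lemma facesP s U :
  reflect (U \subset s /\ {in U &, forall x y, ~~ e x y}) (U \in faces s).
Proof. by apply: (iffP andP) => -[-> /indepP]. Qed.

Lemma faces_down s U A : A \subset U -> U \in faces s -> A \in faces s.
Proof.
move=> AU /facesP[Us iU]; apply/facesP; split; first exact: subset_trans Us.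
by move=> x y xA yA; apply: iU; rewrite (subsetP AU).
Qed.

Lemma faces_setD s A U :
  (U \in faces (s :\: A)) = (U \in faces s) && [disjoint U & A].
Proof. by rewrite !unfold_in /faces subsetD andbAC. Qed.

Definition nonvan s h : bool := ~~ boolp.asbool (acyclic K (faces s) h).

Lemma nonvanPn s h : reflect (acyclic K (faces s) h) (~~ nonvan s h).
Proof. rewrite negbK; exact: boolp.asboolP. Qed.

(** The empty complex has its reduced cohomology in degree -1, so the empty set
of vertices counts as nonvanishing for [h = 0], and is the only one
([nonvan_deg0]). *)
Lemma nonvan0 h : nonvan set0 h = (h == 0%N).
Proof.
have f0 U : (U \in faces set0) = (U == set0).
  apply/facesP/eqP => [[]|->]; first by rewrite subset0 => /eqP.
  by split=> // x y; rewrite inE.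
case: h => [|h]; last first.
  apply/negbTE/nonvanPn => f _; exists (fun _ => 0) => U.
  by rewrite f0 => /eqP ->; rewrite cards0.
apply: contraT => /nonvanPn /(_ (fun _ => 1)) [].
  by move=> U; rewrite f0 => /eqP ->; rewrite cards0.
move=> g /(_ set0); rewrite f0 eqxx cards0 => /(_ isT erefl) /eqP.
by rewrite /delta big_set0 oner_eq0.
Qed.

(** An isolated vertex is a cone point of the independence complex. *)
Lemma nonvan_nonisolated s h x : nonvan s h -> x \in s ->
  exists2 y, y \in s & e x y.
Proof.
move=> hs xs; apply/exists_inP; apply: contraLR hs; rewrite negb_exists_in.
move=> /forall_inP iso; apply/nonvanPn; apply: (acyclic_cone (t := x)) => U.
move=> /facesP[/subsetP Us iU]; apply/facesP; split.
  by apply/subsetP=> y; rewrite !inE => /predU1P[->|/Us].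
move=> y z; rewrite !inE => /predU1P[->|yU] /predU1P[->|zU]; rewrite ?e_irr //.
- by apply: iso; apply: Us.
- by rewrite e_sym; apply: iso; apply: Us.
- exact: iU.
Qed.

Lemma nonvan_deg0 s : nonvan s 0 -> s = set0.
Proof.
move=> hs; apply/eqP; apply: contraLR hs => /set0Pn[x xs]; apply/nonvanPn.
move=> f f0; exists (fun _ => 0) => U _ /eqP; rewrite cards_eq0 => /eqP ->.
have := f0 [set x]; rewrite cards1 /delta big_set1 setDv big_set0.
have -> : nbelow x [set x] = 0%N.
  apply/eqP; rewrite cards_eq0; apply/eqP/setP=> y; rewrite !inE.
  by case: (eqVneq y x) => //= ->; rewrite ltnn.
rewrite mul1r => -> //; apply/facesP; split; first by rewrite sub1set.
by move=> y z; rewrite !inE => /eqP-> /eqP->; rewrite e_irr.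
Qed.

Definition joined A B := {in A & B, forall x y, e x y}.

(** An independent set cannot meet both [A] and [B] when they are joined, so the
complex on [s] is the union of those on [s :\: A] and [s :\: B].  The next three
statements are exactness of the Mayer-Vietoris sequence at its three places. *)
Section MayerVietoris.
Variables A B : {set 'I_n}.
Hypothesis AB : joined A B.

Lemma faces_split s U : U \in faces s ->
  (U \in faces (s :\: A)) || (U \in faces (s :\: B)).
Proof.
rewrite !faces_setD => Us; rewrite Us /=; apply: contraT; rewrite negb_or.
move=> /andP[/pred0Pn[x /andP[/= xU xA]] /pred0Pn[y /andP[/= yU yB]]].
by have /facesP[_ /(_ x y xU yU)] := Us; rewrite AB.
Qed.

Lemma faces_setDD s U :
  (U \in faces (s :\: A :\: B)) = (U \in faces (s :\: A)) && (U \in faces (s :\: B)).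
Proof. by rewrite !faces_setD; case: (U \in faces s). Qed.

(** Local primitives [gA] and [gB] differ on the intersection by a cocycle; once
this is a coboundary they can be glued. *)
Lemma mv_whole s h : nonvan s h.+1 ->
  [|| nonvan (s :\: A) h.+1, nonvan (s :\: B) h.+1 | nonvan (s :\: A :\: B) h].
Proof.
apply: contraTT; rewrite !negb_or => /and3P[/nonvanPn aA /nonvanPn aB /nonvanPn aAB].
apply/nonvanPn => f f0.
have [U|gA fA] := aA f; first by rewrite faces_setD => /andP[/f0].
have [U|gB fB] := aB f; first by rewrite faces_setD => /andP[/f0].
have [U|k kE] := aAB (fun U => gA U - gB U).
  by rewrite faces_setDD => /andP[UA UB] Uh; rewrite deltaB -fA // -fB // subrr.
exists (fun U => if [disjoint U & A] then gA U else gB U + delta k U) => U Us Uh.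
have /orP[UA|UB] := faces_split Us.
  rewrite fA //; apply: eq_delta => u _; rewrite (disjointWl (subD1set _ _)) //.
  by move: UA; rewrite faces_setD => /andP[].
transitivity (delta (fun V => gB V + delta k V) U).
  by rewrite deltaD deltaK addr0 fB.
apply: eq_delta => u uU; case: ifP => // dUA.
rewrite -kE; first by rewrite addrC subrK.
  have UuB := faces_down (subD1set U u) UB.
  rewrite faces_setDD UuB andbT faces_setD dUA andbT.
  exact: faces_down (subD1set U u) Us.
by have := cardsD1 u U; rewrite uU Uh => -[].
Qed.

(** The connecting map sends a cocycle [f] of the intersection to the coboundary
of its extension by zero to [s :\: A]. *)
Lemma mv_meet s h : nonvan (s :\: A :\: B) h ->
  [|| nonvan s h.+1, nonvan (s :\: A) h | nonvan (s :\: B) h].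
Proof.
apply: contraTT; rewrite !negb_or => /and3P[/nonvanPn aS /nonvanPn aA /nonvanPn aB].
apply/nonvanPn => f f0.
pose fA U := if [disjoint U & B] then f U else 0.
pose fAB U := if [disjoint U & A] then delta fA U else 0.
have dAB U : U \in faces (s :\: B) -> #|U| = h.+1 -> fAB U = 0.
  move=> UB Uh; rewrite /fAB; case: ifP => // UA.
  rewrite -[RHS](f0 U) //; last first.
    by rewrite faces_setDD UB andbT; move: UB; rewrite !faces_setD UA andbT => /andP[].
  apply: eq_delta => u _; rewrite /fA (disjointWl (subD1set _ _)) //.
  by move: UB; rewrite faces_setD => /andP[].
have [U Us Uh|g gE] := aS fAB.
  have /orP[UA|UB] := faces_split Us.
    rewrite -[RHS](deltaK fA U); apply: eq_delta => u _.
    rewrite /fAB (disjointWl (subD1set _ _)) //.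
    by move: UA; rewrite faces_setD => /andP[].
  rewrite /delta big1 // => u uU; rewrite dAB ?mulr0 //.
    exact: faces_down (subD1set U u) UB.
  by have := cardsD1 u U; rewrite uU Uh => -[].
have [U UA Uh|a aE] := aA (fun U => fA U - g U).
  move: (UA); rewrite faces_setD => /andP[Us dUA].
  by rewrite deltaB -gE // /fAB dUA subrr.
have [U UB Uh|b bE] := aB g.
  rewrite -gE //; first exact: dAB.
  by move: UB; rewrite faces_setD => /andP[].
exists (fun U => a U + b U) => U; rewrite faces_setDD => /andP[UA UB] Uh.
rewrite deltaD -aE // -bE // subrK /fA ifT //.
by move: UB; rewrite faces_setD => /andP[].
Qed.

(** A cocycle on [s :\: A] that bounds on the intersection extends to [s]. *)
Lemma mv_part s h : nonvan (s :\: A) h ->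
  nonvan s h || nonvan (s :\: A :\: B) h.
Proof.
apply: contraTT; rewrite !negb_or => /andP[/nonvanPn aS /nonvanPn aAB].
apply/nonvanPn => f f0.
have [U|k kE] := aAB f.
  by rewrite faces_setDD => /andP[UA _]; apply: f0.
pose F U := if [disjoint U & A] then f U else delta k U.
have [U Us Uh|g gE] := aS F.
  have /orP[UA|UB] := faces_split Us.
    rewrite -(f0 _ UA Uh); apply: eq_delta => u _.
    rewrite /F (disjointWl (subD1set _ _)) //.
    by move: UA; rewrite faces_setD => /andP[].
  rewrite -[RHS](deltaK k U); apply: eq_delta => u uU.
  rewrite /F; case: ifP => // dUA; apply: kE.
    have UuB := faces_down (subD1set U u) UB.
    rewrite faces_setDD UuB andbT faces_setD dUA andbT.
    exact: faces_down (subD1set U u) Us.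
  by have := cardsD1 u U; rewrite uU Uh => -[].
exists g => U; rewrite faces_setD => /andP[Us dUA] Uh.
by rewrite -gE // /F dUA.
Qed.

End MayerVietoris.
End IndependenceComplex.

(** * Descent along edges and stars *)
Lemma subset_of_card (T : finType) (A : {set T}) k :
  (k <= #|A|)%N -> exists2 B : {set T}, B \subset A & #|B| = k.
Proof.
move=> /card_geqP[l [ul sl lA]]; exists [set x in l].
  by apply/subsetP=> x; rewrite inE => /lA.
by rewrite -sl cardsE; apply/card_uniqP.
Qed.

Lemma card_bigcup_leq (I T : finType) (A : {set I}) (F : I -> {set T}) k :
  (forall i, i \in A -> (#|F i| <= k)%N) ->
  (#|\bigcup_(i in A) F i| <= #|A| * k)%N.
Proof.
move=> Fk; rewrite -sum_nat_const.
elim/big_rec2: _ => [|i m B iA Bm]; first by rewrite cards0.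
by apply: leq_trans (leq_card_setU _ _) _; rewrite leq_add ?Fk.
Qed.

Section EdgeShifts.
Variables (K : fieldType) (n : nat) (e : rel 'I_n).
Hypotheses (e_sym : ssrbool.symmetric e) (e_irr : irreflexive e).
Implicit Types (s t m U : {set 'I_n}).

Local Notation nonvan := (nonvan K e).

Definition nb s x : {set 'I_n} := [set y in s | e x y].

Lemma mem_nb s x y : (y \in nb s x) = (y \in s) && e x y.
Proof. by rewrite inE. Qed.

Lemma e_neq x y : e x y -> x != y.
Proof. by apply: contraTneq => ->; rewrite e_irr. Qed.

(** Some multidegree inside [s] has a nonzero Betti number in homological degree
[i] and total degree at least [i + h]. *)
Definition reach s i h : Prop :=
  exists t k, [/\ t \subset s, (h <= k)%N, nonvan t k & #|t| = (i + k)%N].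

Lemma reach_le s i h k : (k <= h)%N -> reach s i h -> reach s i k.
Proof.
by move=> kh [t [l [ts hl tl tE]]]; exists t, l; split=> //; apply: leq_trans hl.
Qed.

Lemma reach_sub s t i h : t \subset s -> reach t i h -> reach s i h.
Proof.
move=> ts [u [l [ut hl ul uE]]]; exists u, l; split=> //.
exact: subset_trans ts.
Qed.

Lemma reach_nonvan s i h : nonvan s h -> #|s| = (i + h)%N -> reach s i h.
Proof. by move=> sh sE; exists s, h. Qed.

Lemma reach00 s : reach s 0 0.
Proof.
by exists set0, 0%N; split; rewrite ?sub0set ?cards0 // nonvan0.
Qed.

Lemma nonvan_gt0 s h x : nonvan s h -> x \in s -> (0 < h)%N.
Proof.
by case: h => // /(nonvan_deg0 e_irr) ->; rewrite inE.
Qed.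

Lemma nonvan_star s h x U : nonvan s h -> x \in s -> U \subset nb s x ->
  [|| nonvan (s :\ x) h, nonvan (s :\: U) h | nonvan (s :\ x :\: U) h.-1].
Proof.
move=> sh xs /subsetP Ux; have := nonvan_gt0 sh xs; case: h sh => // h sh _.
apply: mv_whole sh => y z; rewrite inE => /eqP -> /Ux.
by rewrite mem_nb => /andP[].
Qed.

Lemma nonvan_edge s h x y : nonvan s h -> x \in s -> y \in s -> e x y ->
  [|| nonvan (s :\ x) h, nonvan (s :\ y) h | nonvan (s :\ x :\ y) h.-1].
Proof.
move=> sh xs ys xy; apply: nonvan_star => //.
by rewrite sub1set mem_nb ys.
Qed.

(** The star of [x] with all its neighbours: deleting only the neighbours would
leave [x] isolated. *)
Lemma nonvan_link s h x : nonvan s h -> x \in s ->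
  nonvan (s :\ x) h || nonvan (s :\ x :\: nb s x) h.-1.
Proof.
move=> sh xs; have /or3P[->//|iso|->] := nonvan_star sh xs (subxx _).
  have xsN : x \in s :\: nb s x by rewrite inE xs mem_nb e_irr andbF.
  have [y] := nonvan_nonisolated e_sym e_irr iso xsN.
  by rewrite inE mem_nb => /andP[/nandP[/negP//|/negP//]].
by rewrite orbT.
Qed.

Lemma cardsD1E s x : x \in s -> #|s| = #|s :\ x|.+1.
Proof. by move=> xs; rewrite (cardsD1 x) xs. Qed.

Lemma reach_edge s i h : reach s i.+1 h -> reach s i h.-1.
Proof.
move=> [t [k [ts hk tk tE]]]; apply: (reach_sub ts).
have [x xt] : exists x, x \in t by apply/set0Pn; rewrite -card_gt0 tE.
have [y yt xy] := nonvan_nonisolated e_sym e_irr tk xt.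
have k0 := nonvan_gt0 tk xt.
have yx : y \in t :\ x by rewrite !inE yt eq_sym e_neq.
have tx := cardsD1E xt; have ty := cardsD1E yt; have txy := cardsD1E yx.
have /or3P[d|d|d] := nonvan_edge tk xt yt xy.
- by exists (t :\ x), k; split; rewrite ?subD1set //; lia.
- by exists (t :\ y), k; split; rewrite ?subD1set //; lia.
- exists (t :\ x :\ y), k.-1; split=> //; try lia.
  by rewrite !subDset setUA subsetUr.
Qed.

Lemma reach_drop s i k h : reach s (i + k) h -> reach s i (h - k).
Proof.
elim: k h => [|k IH] h; first by rewrite addn0 subn0.
by rewrite addnS => /reach_edge /IH; rewrite -subn1 -subnDA add1n.
Qed.

Lemma reach_pos s i h : reach s i.+1 h -> reach s i.+1 1.
Proof.
move=> [t [k [ts hk tk tE]]]; exists t, k; split=> //.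
have [x xt] : exists x, x \in t by apply/set0Pn; rewrite -card_gt0 tE.
exact: nonvan_gt0 tk xt.
Qed.

Lemma reach_diag s i j : (i <= j)%N -> reach s j j -> reach s i i.
Proof.
move=> ij; rewrite -{1}(subnKC ij) => /reach_drop; apply: reach_le; lia.
Qed.

Lemma nonvan_card s h : nonvan s h -> (h + h <= #|s|)%N.
Proof.
move: {2}#|s| (erefl #|s|) => N; elim/ltn_ind: N s h => N IH s h sN sh.
have [s0|[x xs]] := set_0Vmem s.
  by move: sh; rewrite s0 nonvan0 => /eqP ->.
have [y ys xy] := nonvan_nonisolated e_sym e_irr sh xs.
have h0 := nonvan_gt0 sh xs.
have yx : y \in s :\ x by rewrite !inE ys eq_sym e_neq.
have tx := cardsD1E xs; have ty := cardsD1E ys; have txy := cardsD1E yx.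
have /or3P[/IH|/IH|/IH] := nonvan_edge sh xs ys xy.
- by move=> /(_ _ _ erefl); lia.
- by move=> /(_ _ _ erefl); lia.
- by move=> /(_ _ _ erefl); lia.
Qed.

(** In a matching, deleting one end of an edge isolates the other end, so each
edge removed costs exactly one unit of [h]. *)
Lemma nonvan_matching s h : (forall x, x \in s -> (#|nb s x| <= 1)%N) ->
  nonvan s h -> #|s| = (h + h)%N.
Proof.
move: {2}#|s| (erefl #|s|) => N; elim/ltn_ind: N s h => N IH s h sN mt sh.
have [s0|[x xs]] := set_0Vmem s.
  by move: sh; rewrite s0 nonvan0 => /eqP ->; rewrite cards0.
have [y ys xy] := nonvan_nonisolated e_sym e_irr sh xs.
have h0 := nonvan_gt0 sh xs.
have yx : y \in s :\ x by rewrite !inE ys eq_sym e_neq.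
have tx := cardsD1E xs; have txy := cardsD1E yx.
have absurd u w : u \in s -> w \in s -> e u w -> ~~ nonvan (s :\ u) h.
  move=> us ws uw; apply/negP => su.
  have wu : w \in s :\ u by rewrite !inE ws eq_sym e_neq.
  have [z] := nonvan_nonisolated e_sym e_irr su wu; rewrite !inE => /andP[zu zs] wz.
  have /card_le1_eqP/(_ u z) := mt w ws.
  rewrite !mem_nb us zs e_sym uw wz => /(_ isT isT) uz.
  by rewrite uz eqxx in zu.
have := nonvan_edge sh xs ys xy.
rewrite (negbTE (absurd _ _ xs ys xy)) (negbTE (absurd y x _ _ _)) 1?e_sym //=.
move=> d; have := IH _ _ _ _ erefl _ d; rewrite tx txy => ->; try lia.
move=> z; rewrite !inE => /and3P[zy zx zs]; apply: leq_trans (mt z zs).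
apply: subset_leq_card; apply/subsetP => w; rewrite !mem_nb.
by rewrite !inE => /andP[/and3P[_ _ ->]].
Qed.

(** With [b + 1] leaves, the star jumps over [b + 1] homological degrees unless
the centre can be deleted at no cost. *)
Lemma star_reach s a b h x U : nonvan s h -> #|s| = (a + b.+1 + h)%N ->
  x \in s -> U \subset nb s x -> #|U| = b.+1 ->
  nonvan (s :\ x) h \/ reach s a h.-1.
Proof.
move=> sh sE xs Ux Ub.
have Us : U \subset s :\ x.
  apply: subset_trans Ux _; apply/subsetP=> y; rewrite mem_nb !inE.
  by move=> /andP[-> /e_neq]; rewrite eq_sym => ->.
have Us' : U \subset s by apply: subset_trans Us (subD1set _ _).
have h0 := nonvan_gt0 sh xs; have tx := cardsD1E xs.
have /or3P[d|d|d] := nonvan_star sh xs Ux; [by left|right|right].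
  apply: (reach_le (leq_pred _)); apply: (reach_sub (subsetDl _ U)).
  by apply: reach_nonvan d _; rewrite cardsDS //; lia.
apply: (reach_sub (subset_trans (subsetDl _ U) (subD1set _ _))).
by apply: reach_nonvan d _; rewrite cardsDS //; lia.
Qed.

(** Two homological degrees for one unit of [h]; the alternative is that the set
that carries the class is an induced matching. *)
Lemma reach_cherry s i h : reach s i.+2 h ->
  reach s i h.-1 \/ reach s i.+2 i.+2.
Proof.
move=> [t [k [ts hk tk tE]]].
have [/existsP[x /andP[xt x2]]|/existsPn mt] :=
  boolP [exists x, (x \in t) && (1 < #|nb t x|)%N]; last first.
  right; apply: (reach_sub ts); exists t, k; split=> //.
  have tm := @nonvan_matching t k _ tk; rewrite tE in tm.
  suff : (i.+2 + k = k + k)%N by lia.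
  by apply: tm => x xt; rewrite leqNgt; have := mt x; rewrite xt.
left; apply: (reach_sub ts).
have [U Ux U2] := subset_of_card x2.
have tE' : #|t| = (i + 2 + k)%N by rewrite tE addn2.
have [d|] := star_reach tk tE' xt Ux U2.
  apply: (reach_sub (subD1set _ x)); apply: reach_le (reach_edge (h := k) _); first lia.
  by apply: reach_nonvan => //; have := cardsD1E xt; lia.
by apply: reach_le; lia.
Qed.

Definition gapfree s : Prop := forall p q r w, p \in s -> q \in s -> r \in s ->
  w \in s -> e p q -> e r w -> [|| e p r, e p w, e q r | e q w].

Lemma gapfree_sub s t : t \subset s -> gapfree s -> gapfree t.
Proof.
by move=> /subsetP ts gs p q r u pt qt rt ut; apply: gs; apply: ts.
Qed.

(** If [x] cannot be deleted, the class lives on the non-neighbours [W] of [x],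
which then have no isolated vertex.  For a neighbour [u] of [x], every edge of [W]
has an end in [C], the neighbours of [u] in [W]: otherwise it would form a gap with
[x u].  So [W] is covered by [C] and its neighbours, and both are few because
[x] and [u] already take up one neighbour of [u] and of each vertex of [C]. *)
Lemma gapfree_bounded s h D x : gapfree s -> nonvan s h ->
  (forall y, y \in s -> (#|nb s y| <= D)%N) -> x \in s ->
  ~~ nonvan (s :\ x) h -> (#|s| <= (D * D).+1)%N.
Proof.
move=> gf sh degD xs nx; have := nonvan_link sh xs; rewrite (negbTE nx) /=.
set W := s :\ x :\: nb s x => Wh.
have [u us xu] := nonvan_nonisolated e_sym e_irr sh xs.
have ux : e u x by rewrite e_sym.
have Ws : W \subset s by apply: subset_trans (subsetDl _ _) (subD1set _ _).
have WE w : w \in W -> [/\ w \in s, w != x & ~~ e x w].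
  by rewrite !inE => /and3P[+ -> ws]; rewrite ws.
have uW : u \notin W by apply/negP => /WE[_ _]; rewrite xu.
pose C := nb W u.
have Cdeg : (#|C|.+1 <= D)%N.
  apply: leq_trans (degD u us).
  rewrite [leqRHS](cardsD1 x) mem_nb xs ux add1n ltnS.
  apply: subset_leq_card; apply/subsetP=> w; rewrite !(mem_nb, inE).
  by move=> /andP[/and3P[_ -> ->] ->].
have WC : W \subset \bigcup_(c in C) (c |: nb W c).
  apply/subsetP=> w wW; have [w' w'W ww'] := nonvan_nonisolated e_sym e_irr Wh wW.
  have [ws _ xw] := WE w wW; have [w's _ xw'] := WE w' w'W.
  have := gf _ _ _ _ xs us ws w's xu ww'; rewrite (negbTE xw) (negbTE xw') /=.
  case/orP => uw; apply/bigcupP.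
    by exists w; rewrite ?setU11 // mem_nb wW.
  by exists w'; rewrite ?mem_nb ?w'W // in_setU1 mem_nb wW e_sym ww' orbT.
have Wcard : (#|W| <= #|C| * D)%N.
  apply: leq_trans (subset_leq_card WC) _; apply: card_bigcup_leq => c.
  rewrite mem_nb => /andP[cW uc]; have [cs _ _] := WE c cW.
  rewrite cardsU1; apply: leq_trans (degD c cs).
  rewrite [leqRHS](cardsD1 u) [u \in _]mem_nb us [e c u]e_sym uc.
  apply: leq_add; first by case: (_ \notin _).
  apply: subset_leq_card; apply/subsetP=> w; rewrite in_setD1 !mem_nb.
  case/andP=> wW cw; have [-> _ _] := WE w wW; rewrite cw !andbT.
  by apply: contraTneq wW => ->.
have sW : (#|s :\ x| <= D + #|W|)%N.
  rewrite -(cardsID (nb s x) (s :\ x)) leq_add2r; apply: leq_trans (degD x xs).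
  exact/subset_leq_card/subsetIr.
rewrite (cardsD1E xs) ltnS; apply: leq_trans sW _.
apply: leq_trans (leq_add (leqnn D) Wcard) _; rewrite -mulSn leq_mul2r.
by rewrite Cdeg orbT.
Qed.

(** A star with [b + 1] leaves if there is one; otherwise the degrees are at most
[b], and by [gapfree_bounded] a set with more than [b * b + 1] vertices loses a
vertex at no cost. *)
Lemma gapfree_reach s b : gapfree s -> forall t a h, t \subset s ->
  nonvan t h -> #|t| = (a + b.+1 + h)%N -> ((b * b).+2 <= #|t|)%N ->
  reach t a h.-1.
Proof.
move=> gf; elim: b => [|b IH] t a h ts th tE tb.
  by apply: reach_edge; apply: reach_nonvan => //; lia.
have IHx x : x \in t -> nonvan (t :\ x) h -> reach t a h.-1.
  move=> xt d; have := cardsD1E xt => tx.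
  apply: (reach_sub (subD1set _ x)); apply: IH => //; last by nia.
    exact: subset_trans (subD1set _ _) ts.
  by lia.
have [/existsP[x /andP[xt x2]]|/existsPn mt] :=
  boolP [exists x, (x \in t) && (b.+2 <= #|nb t x|)%N].
  have [U Ux U2] := subset_of_card x2.
  by have [/(IHx x xt)|] := star_reach (a := a) th tE xt Ux U2.
have [x xt] : exists x, x \in t by apply/set0Pn; rewrite -card_gt0; lia.
apply: (IHx x xt); apply: contraLR tb => nx; rewrite -ltnNge ltnS.
apply: (gapfree_bounded (gapfree_sub ts gf) th _ xt nx) => y yt.
by have := mt y; rewrite yt /= -ltnNge ltnS.
Qed.

(** Adding a disjoint edge suspends the complex. *)
Lemma nonvan_suspend s h x y : nonvan s h -> e x y ->
  nb s x = set0 -> nb s y = set0 -> nonvan (x |: (y |: s)) h.+1.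
Proof.
move=> sh xy nx ny.
have xs : x \notin s.
  apply/negP=> xs; have [z zs xz] := nonvan_nonisolated e_sym e_irr sh xs.
  by have /setP/(_ z) := nx; rewrite mem_nb zs xz inE.
have ys : y \notin s.
  apply/negP=> ys; have [z zs xz] := nonvan_nonisolated e_sym e_irr sh ys.
  by have /setP/(_ z) := ny; rewrite mem_nb zs xz inE.
have nxy := e_neq xy.
set t := x |: (y |: s).
have tx : t :\ x = y |: s.
  by rewrite setU1K // !inE negb_or nxy.
have ty : t :\ y = x |: s.
  by rewrite /t setUCA setU1K // !inE negb_or eq_sym nxy.
have txy : t :\ x :\ y = s by rewrite tx setU1K.
have AB : joined e [set x] [set y] by move=> u w /set1P-> /set1P->.
have := @mv_meet K n e [set x] [set y] AB t h; rewrite txy => /(_ sh).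
have absurd u : nb s u = set0 -> ~~ nonvan (u |: s) h.
  move=> nu; apply/negP => /(nonvan_nonisolated e_sym e_irr) /(_ (setU11 _ _)) [z].
  rewrite !inE => /predU1P[->|zs uz]; first by rewrite e_irr.
  by have /setP/(_ z) := nu; rewrite mem_nb zs uz inE.
by rewrite tx ty (negbTE (absurd _ ny)) (negbTE (absurd _ nx)) !orbF.
Qed.

(** The class dies in [x |: s] only by bounding in the cone over the link of [x],
and then the link itself has homology. *)
Lemma nonvan_extend s h x : nonvan s h -> x \notin s ->
  nonvan (x |: s) h || nonvan (s :\: nb s x) h.
Proof.
move=> sh xs; have AB : joined e [set x] (nb s x).
  by move=> u w /set1P->; rewrite mem_nb => /andP[].
by have := @mv_part K n e [set x] _ AB (x |: s) h; rewrite setU1K // => /(_ sh).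
Qed.

(** With [k + k] vertices, as in the boundary of a cross-polytope, [m] is as small
as its cohomology allows ([nonvan_card]), so no proper part of it, such as the link
of [x], has cohomology in the same degree. *)
Lemma sphere_extend m k x : nonvan m k -> #|m| = (k + k)%N -> x \notin m ->
  nb m x != set0 -> nonvan (x |: m) k.
Proof.
move=> mk mE xm nx; have /orP[//|/nonvan_card] := nonvan_extend mk xm.
have /subset_leqif_card/leqifP : m :\: nb m x \subset m by apply: subsetDl.
have [/subsetP sub|_] := boolP (m \subset _); last by lia.
by case/set0Pn: nx => y; rewrite mem_nb => /andP[ym xy]; have := sub y ym;
   rewrite inE mem_nb ym xy.
Qed.

Definition unattached m y : Prop := y \notin m /\ nb m y = set0.

Lemma unattached_suspend m k x y : nonvan m k -> #|m| = (k + k)%N ->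
  unattached m x -> unattached m y -> e x y ->
  nonvan (x |: (y |: m)) k.+1 /\ #|x |: (y |: m)| = (k.+1 + k.+1)%N.
Proof.
move=> mk mE [xm nx] [ym ny] xy; split; first exact: nonvan_suspend.
by rewrite !cardsU1 !inE ym negb_or e_neq // xm mE; lia.
Qed.

(** Either a vertex outside [m] is attached to [m], and [sphere_extend] applies, or
an edge disjoint from [m] extends the matching. *)
Lemma matching_grow s h m k : nonvan s h -> m \subset s -> nonvan m k ->
  #|m| = (k + k)%N -> (#|m| < #|s|)%N -> reach s k.+1 k.
Proof.
move=> sh ms mk mE mlt.
have sub1 x : x \in s -> x |: m \subset s.
  by move=> xs; rewrite subUset sub1set xs.
have att x : x \in s -> x \notin m -> nb m x != set0 -> reach s k.+1 k.
  move=> xs xm nx; exists (x |: m), k; split; rewrite ?sub1 //.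
    exact: sphere_extend.
  by rewrite cardsU1 xm; lia.
have [x xs xm] : exists2 x, x \in s & x \notin m.
  apply/subsetPn; apply: contraL mlt => /subset_leq_card.
  by rewrite -leqNgt.
have [nx|] := eqVneq (nb m x) set0; last exact: att xs xm.
have [y ys xy] := nonvan_nonisolated e_sym e_irr sh xs.
have ym : y \notin m.
  by apply/negP => ym; have /setP/(_ y) := nx; rewrite mem_nb ym xy inE.
have [ny|] := eqVneq (nb m y) set0; last exact: att ys ym.
have [d dE] := unattached_suspend mk mE (conj xm nx) (conj ym ny) xy.
apply: (reach_le (leqnSn k)); exists (x |: (y |: m)), k.+1; split=> //.
by rewrite subUset sub1set xs sub1.
Qed.

End EdgeShifts.

Lemma double_pred_gt3 h k : (2 < h)%N -> (h.-1 + h.-1 <= k)%N -> (3 < k)%N.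
Proof. lia. Qed.

(** * Graphs containing two disjoint edges without connecting edge *)
Section Gaps.
Variables (K : fieldType) (n : nat) (e : rel 'I_n).
Hypotheses (e_sym : ssrbool.symmetric e) (e_irr : irreflexive e).
Implicit Types (s m U : {set 'I_n}) (p q r t x y z : 'I_n).

Local Notation nonvan := (nonvan K e).
Local Notation reach := (reach K e).
Local Notation nb := (nb e).

Definition four p q r t : {set 'I_n} := p |: (q |: (r |: (t |: set0))).

(** The last two clauses follow from the others ([gapI]); they record that the
complex of a gap is a 4-cycle. *)
Definition gap s p q r t : Prop :=
  four p q r t \subset s /\
  [/\ e p q, e r t, [&& ~~ e p r, ~~ e p t, ~~ e q r & ~~ e q t],
      nonvan (four p q r t) 2 & #|four p q r t| = 4].

Lemma in_four p q r t x :
  (x \in four p q r t) = [|| x == p, x == q, x == r | x == t].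
Proof. by rewrite !inE orbF. Qed.

Lemma gapI s p q r t : p \in s -> q \in s -> r \in s -> t \in s ->
  e p q -> e r t -> ~~ e p r -> ~~ e p t -> ~~ e q r -> ~~ e q t ->
  gap s p q r t.
Proof.
move=> ps qs rs ts pq rt pr pt qr qt.
have nb0 x : nb set0 x = set0 by apply/setP=> y; rewrite !inE.
have two : nonvan (r |: (t |: set0)) 1.
  by apply: nonvan_suspend => //; rewrite nonvan0.
have nbrt x : ~~ e x r -> ~~ e x t -> nb (r |: (t |: set0)) x = set0.
  move=> xr xt; apply/setP=> y; rewrite !inE orbF; apply/negP.
  by case/andP=> /orP[/eqP->|/eqP->]; apply/negP.
split; first by rewrite !subUset !sub1set ps qs rs ts sub0set.
split=> //; first by rewrite pr pt qr qt.
  by apply: nonvan_suspend => //; apply: nbrt.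
have npr : p != r by apply: contraNneq qr => <-; rewrite e_sym.
have npt : p != t by apply: contraNneq qt => <-; rewrite e_sym.
have nqr : q != r by apply: contraNneq pr => <-.
have nqt : q != t by apply: contraNneq pt => <-.
rewrite /four !cardsU1 !inE cards0 !orbF !negb_or.
by rewrite (e_neq e_irr pq) (e_neq e_irr rt) npr npt nqr nqt.
Qed.

Lemma not_gapfree s : ~ gapfree e s -> exists p q r t, gap s p q r t.
Proof.
move=> ng; apply: boolp.contrapT => nex; apply: ng => p q r t ps qs rs ts pq rt.
apply: contraT; rewrite !negb_or => /and4P[pr pt qr qt].
by case: nex; exists p, q, r, t; apply: gapI.
Qed.

Lemma gap_swap s p q r t : gap s p q r t -> gap s p q t r.
Proof.
move=> [/subsetP sub [pq rt /and4P[pr pt qr qt] _ _]].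
by apply: gapI; rewrite ?(e_sym t) // sub // in_four eqxx ?orbT.
Qed.

Lemma gap_sym s p q r t : gap s p q r t -> gap s r t p q.
Proof.
move=> [/subsetP sub [pq rt /and4P[pr pt qr qt] _ _]].
by apply: gapI; rewrite // 1?e_sym // sub // in_four eqxx ?orbT.
Qed.

Lemma mem_gap s p q r t : gap s p q r t ->
  [/\ p \in s, q \in s, r \in s & t \in s].
Proof.
by case=> /subsetP sub _; split; apply: sub; rewrite in_four eqxx ?orbT.
Qed.

Definition attached p q r t x : bool :=
  (x \notin four p q r t) && [|| e x p, e x q, e x r | e x t].

Lemma unattachedP p q r t x : x \notin four p q r t ->
  ~~ attached p q r t x -> unattached e (four p q r t) x.
Proof.
move=> xm; rewrite /attached xm /= !negb_or => /and4P[xp xq xr xt]; split=> //.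
apply/setP=> y; rewrite mem_nb in_four !inE; apply/negP.
by case/andP=> /or4P[]/eqP->; apply/negP.
Qed.

(** The case of homological degree 4 where only total degree 5 occurs: a set of 6
vertices with cohomology in degree 1 is excluded, and so are induced matchings
with 3 edges.  This forces the graph around a gap. *)
Section LinearStrand.
Variables (s : {set 'I_n}) (h : nat).
Hypotheses (sh : nonvan s h) (no42 : ~ reach s 4 2) (s7 : (6 < #|s|)%N).

Lemma no_matching3 m : m \subset s -> nonvan m 3 -> #|m| <> 6%N.
Proof.
move=> ms mk mE; apply: no42; apply: (reach_le (h := 3)) => //.
by apply: (matching_grow e_sym e_irr sh ms (k := 3)); rewrite ?mE //.
Qed.

Lemma unattached_stable p q r t x y : gap s p q r t -> x \in s -> y \in s ->
  x \notin four p q r t -> y \notin four p q r t ->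
  ~~ attached p q r t x -> ~~ attached p q r t y -> ~~ e x y.
Proof.
move=> [ms [_ _ _ m2 m4]] xs ys xm ym xa ya; apply/negP => xy.
have [d dE] :=
  unattached_suspend e_sym e_irr m2 m4 (unattachedP xm xa) (unattachedP ym ya) xy.
apply: (no_matching3 _ d dE).
by rewrite subUset sub1set xs subUset sub1set ys.
Qed.

(** Otherwise [y |: m] would be an excluded set of 6 vertices, so the class dies
by adding [y] and survives on the link, which needs 4 of the 5 vertices. *)
Lemma five_nb m y : m \subset s -> nonvan m 2 -> #|m| = 5%N -> y \in s ->
  y \notin m -> (#|nb m y| <= 1)%N /\ nonvan (m :\: nb m y) 2.
Proof.
move=> ms m2 m5 ys ym; have /orP[d|d] := nonvan_extend m2 ym.
  case: no42; exists (y |: m), 2%N; split=> //; last by rewrite cardsU1 ym m5.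
  by rewrite subUset sub1set ys.
split=> //; have := nonvan_card e_sym e_irr d.
rewrite cardsDS; last by apply/subsetP=> z; rewrite mem_nb => /andP[].
by rewrite m5; lia.
Qed.

(** Apart from a vertex [x] attached at [r], the only way to attach a further
vertex [y] is at the other end [t] of the same edge, making [x r t y] an induced
path: its complex is contractible, which is why this case escapes [five_nb]. *)
Lemma attached_pair p q r t x y : gap s p q r t -> x \in s ->
  x \notin four p q r t -> e x r -> y \in s -> attached p q r t y -> y != x ->
  [/\ e y t, [&& ~~ e x p, ~~ e x q & ~~ e x t],
      [&& ~~ e y p, ~~ e y q & ~~ e y r] & ~~ e x y].
Proof.
move=> gp xs xm xr ys /andP[ym ya] yx.
have [ps qs rs ts] := mem_gap gp.
have [ms [pq rt /and4P[pr pt qr qt] m2 m4]] := gp.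
set m := four p q r t in ms m2 m4 xm ym.
have [pm qm rm tm] : [/\ p \in m, q \in m, r \in m & t \in m].
  by split; rewrite in_four eqxx ?orbT.
have nbN0 z w : w \in m -> e z w -> nb m z != set0.
  by move=> wm zw; apply/set0Pn; exists w; rewrite mem_nb wm.
have grow z : z \in s -> z \notin m -> nb m z != set0 ->
    [/\ z |: m \subset s, nonvan (z |: m) 2 & #|z |: m| = 5%N].
  move=> zs zm nz; rewrite subUset sub1set zs ms cardsU1 zm m4; split=> //.
  exact: sphere_extend.
have ny : nb m y != set0 by case/or4P: ya; apply: nbN0.
have [xs5 x2 x5] := grow x xs xm (nbN0 x r rm xr).
have [ys5 y2 y5] := grow y ys ym ny.
have [|ny1 d] := five_nb xs5 x2 x5 ys.
  by rewrite !inE negb_or yx; move: ym; rewrite !inE.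
have [|nx1 _] := five_nb ys5 y2 y5 xs.
  by rewrite !inE negb_or eq_sym yx; move: xm; rewrite !inE.
have uniq_x z : z \in y |: m -> e x z -> z = r.
  move=> zm xz; have /card_le1_eqP/(_ r z) := nx1.
  by rewrite !mem_nb zm xz xr (setU1r y rm); apply.
have neq z w : ~~ e p z -> e p w -> z != w.
  by move=> pz pw; apply: contraNneq pz => ->.
have npr : p != r by apply: contraNneq qr => <-; rewrite e_sym.
have nqr : q != r by apply: contraNneq pr => <-.
have ntr : t != r by rewrite eq_sym (e_neq e_irr rt).
have xz z : z \in y |: m -> z != r -> ~~ e x z.
  by move=> zm zr; apply: contraNN zr => /(uniq_x z zm) ->.
have xp : ~~ e x p by apply: xz => //; apply: setU1r.
have xq : ~~ e x q by apply: xz => //; apply: setU1r.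
have xt : ~~ e x t by apply: xz => //; apply: setU1r.
have xy : ~~ e x y.
  apply: xz; first exact: setU11.
  by apply: contraNneq ym => ->.
have uniq_y z w : z \in m -> w \in m -> e y z -> e y w -> z = w.
  move=> zm wm yz yw; have /card_le1_eqP/(_ w z) := ny1.
  by rewrite !mem_nb yz yw (setU1r x zm) (setU1r x wm); apply.
(* By [five_nb], deleting the neighbour z of y leaves a complex with homology,
   so no vertex w may have z as its only neighbour. *)
have step z w : z \in m -> w \in x |: m -> w != z -> e y z ->
    (forall v, v \in x |: m -> e w v -> v = z) -> False.
  move=> zm wm wz yz wv.
  have wd : w \in (x |: m) :\: nb (x |: m) y.
    rewrite inE wm andbT mem_nb wm /=; apply: contraNN wz => yw; apply/eqP.
    have /card_le1_eqP/(_ z w) := ny1.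
    by rewrite !mem_nb wm yw yz (setU1r x zm); apply.
  have [v] := nonvan_nonisolated e_sym e_irr d wd.
  rewrite inE mem_nb => /andP[vn vm] /(wv v vm) vz.
  by move: vn; rewrite vm vz yz.
have yp : ~~ e y p.
  apply/negP=> yp; apply: (step p q pm (setU1r x qm) _ yp).
    by rewrite eq_sym (e_neq e_irr pq).
  move=> v; rewrite in_setU1 in_four => /predU1P[->|].
    by rewrite e_sym (negbTE xq).
  by case/or4P=> /eqP-> //; rewrite ?e_irr ?(negbTE qr) ?(negbTE qt).
have yq : ~~ e y q.
  apply/negP=> yq; apply: (step q p qm (setU1r x pm) _ yq).
    by rewrite (e_neq e_irr pq).
  move=> v; rewrite in_setU1 in_four => /predU1P[->|].
    by rewrite e_sym (negbTE xp).
  by case/or4P=> /eqP-> //; rewrite ?e_irr ?(negbTE pr) ?(negbTE pt).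
have yr : ~~ e y r.
  apply/negP=> yr; apply: (step r x rm (setU11 x m) _ yr).
    by rewrite (e_neq e_irr xr).
  move=> v; rewrite in_setU1 in_four => /predU1P[->|]; first by rewrite e_irr.
  by case/or4P=> /eqP-> //; rewrite ?(negbTE xp) ?(negbTE xq) ?(negbTE xt).
move: ya; rewrite (negbTE yp) (negbTE yq) (negbTE yr) /= => yt.
by rewrite xp xq xt xy.
Qed.

Lemma attached_swap p q r t x : attached p q t r x = attached p q r t x.
Proof.
by rewrite /attached !in_four (orbC (x == t)) (orbC (e x t)).
Qed.

Lemma attached_sym p q r t x : attached r t p q x = attached p q r t x.
Proof.
have orb4 a b c d : [|| a, b, c | d] = [|| c, d, a | b].
  by case: a; case: b; case: c; case: d.
by rewrite /attached !in_four orb4 (orb4 (e x r)).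
Qed.

(** Two vertices other than [x] would both be attached at [t]; but seen from the
first of them, the second must be attached at [r]. *)
Lemma attached_three p q r t x y z : gap s p q r t -> 
  x \in s -> y \in s -> z \in s ->
  attached p q r t x -> attached p q r t y -> attached p q r t z ->
  x != y -> y != z -> z != x -> False.
Proof.
have main p' q' r' t' : gap s p' q' r' t' ->
  x \in s -> y \in s -> z \in s ->
  attached p' q' r' t' x -> attached p' q' r' t' y -> attached p' q' r' t' z ->
  x != y -> y != z -> z != x -> e x r' -> False.
  move=> gp xs ys zs xa ya za xy yz zx xr.
  have /andP[xm _] := xa; have /andP[ym _] := ya.
  have [|yt _ _ _] := attached_pair gp xs xm xr ys ya; first by rewrite eq_sym.
  have [zt _ /and3P[_ _ zr] _] := attached_pair gp xs xm xr zs za zx.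
  have [|||zr' _ _ _] := @attached_pair p' q' t' r' y z (gap_swap gp) ys _ yt zs.
  - by move: ym; rewrite !in_four !negb_or => /and4P[-> -> -> ->].
  - by rewrite attached_swap.
  - by rewrite eq_sym.
  - by rewrite zr' in zr.
move=> gp xs ys zs xa ya za xy yz zx.
have /andP[_ /or4P[] xe] := xa.
- apply: (main r t p q) => //; rewrite 1?attached_sym //; exact: gap_sym.
- apply: (main r t q p) => //; rewrite 1?attached_swap 1?attached_sym //.
  exact/gap_swap/gap_sym.
- exact: (main p q r t).
- apply: (main p q t r) => //; rewrite 1?attached_swap //; exact: gap_swap.
Qed.

Lemma exists_attached p q r t : gap s p q r t ->
  exists2 x, x \in s & attached p q r t x.
Proof.
move=> gp; have [ms [_ _ _ m2 m4]] := gp.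
have [x xs xm] : exists2 x, x \in s & x \notin four p q r t.
  apply/subsetPn; apply: contraL s7 => /subset_leq_card; lia.
have [xa|xa] := boolP (attached p q r t x); first by exists x.
have [y ys xy] := nonvan_nonisolated e_sym e_irr sh xs.
have ym : y \notin four p q r t.
  apply/negP=> ym; have [_ /setP/(_ y)] := unattachedP xm xa.
  by rewrite mem_nb ym xy inE.
exists y => //; apply: contraT => ya.
by have := unattached_stable gp xs ys xm ym xa ya; rewrite xy.
Qed.

(** All vertices that are not attached to the gap are adjacent to an attached one,
since an edge among them would give three disjoint edges.  If two vertices [x] and
[y] are attached, the gaps [p q x r] and [p q y t] have at most two attached
vertices each, so at most 8 vertices exist.  If only [x] is attached, the others
are leaves at [x]: the class must then live on the non-neighbours of [x], which are
at most 3 of the 4 vertices of the gap. *)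
Lemma gap_absurd p q r t : (2 < h)%N -> (8 < #|s|)%N -> ~ gap s p q r t.
Proof.
move=> h3 s9.
suff main p' q' r' t' x : gap s p' q' r' t' -> x \in s ->
    attached p' q' r' t' x -> e x r' -> False.
  move=> gp; have [x xs xa] := exists_attached gp.
  have /andP[_ /or4P[] xe] := xa.
  - apply: (main r t p q x) => //; rewrite 1?attached_sym //; exact: gap_sym.
  - apply: (main r t q p x) => //; rewrite 1?attached_swap 1?attached_sym //.
    exact/gap_swap/gap_sym.
  - exact: (main p q r t x).
  - apply: (main p q t r x) => //; rewrite 1?attached_swap //; exact: gap_swap.
move: p' q' r' t' => {}p {}q {}r {}t gp xs xa xr.
have [ps qs rs ts] := mem_gap gp; have /andP[xm _] := xa.
have [ms [pq rt /and4P[pr pt qr qt] m2 m4]] := gp.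
have nbr v : v \in s -> v \notin four p q r t -> ~~ attached p q r t v ->
  exists2 w, w \in s & e v w /\ attached p q r t w.
  move=> vs vm va; have [w ws vw] := nonvan_nonisolated e_sym e_irr sh vs.
  exists w => //; split=> //; have wm : w \notin four p q r t.
    apply/negP=> wm; have [_ /setP/(_ w)] := unattachedP vm va.
    by rewrite mem_nb wm vw inE.
  apply: contraT => wa.
  by have := unattached_stable gp vs ws vm wm va wa; rewrite vw.
have [/existsP[y /and3P[ys ya yx]]|/existsPn nex] :=
  boolP [exists y, [&& y \in s, attached p q r t y & y != x]].
  have [yt /and3P[xp xq xt] /and3P[yp yq yr] xy] :=
    attached_pair gp xs xm xr ys ya yx.
  have /andP[ym _] := ya.
  pose X := [set v in s | e v x & v \notin x |: (y |: four p q r t)].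
  pose Y := [set v in s | e v y & v \notin x |: (y |: four p q r t)].
  have out v : v \notin x |: (y |: four p q r t) ->
      [/\ v != x, v != y & [&& v != p, v != q, v != r & v != t]].
    by rewrite in_setU1 in_setU1 in_four !negb_or => /and3P[-> -> ->].
  have card1 z r' t' (Z : {set 'I_n}) : gap s p q z r' -> t' \in s ->
      attached p q z r' t' -> t' \in four p q r t ->
      (forall v, v \in Z ->
         [/\ v \in s, e v z, v \notin x |: (y |: four p q r t)
           & v \notin four p q z r']) ->
      (#|Z| <= 1)%N.
    move=> gz t's t'a t'm ZP; rewrite leqNgt; apply/negP => /card_gt1P.
    move=> [v [w [/ZP[vs vz vo vf] /ZP[ws wz wo wf] vw]]].
    apply: (@attached_three p q z r' t' v w gz) => //.
    - by rewrite /attached vf vz !orbT.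
    - by rewrite /attached wf wz !orbT.
    - by apply: contraNneq vo => <-; rewrite in_setU1 in_setU1 t'm !orbT.
    - by apply: contraNneq wo => ->; rewrite in_setU1 in_setU1 t'm !orbT.
  have npt : t != p by apply: contraNneq qt => ->; rewrite e_sym.
  have nqt : t != q by apply: contraNneq pt => ->.
  have npr : r != p by apply: contraNneq qr => ->; rewrite e_sym.
  have nqr : r != q by apply: contraNneq pr => ->.
  have nrt := e_neq e_irr rt.
  have /norP[nxp /norP[nxq /norP[nxr nxt]]] : ~~ [|| x == p, x == q, x == r | x == t].
    by rewrite -in_four.
  have /norP[nyp /norP[nyq /norP[nyr nyt]]] : ~~ [|| y == p, y == q, y == r | y == t].
    by rewrite -in_four.
  have X1 : (#|X| <= 1)%N.
    apply: (card1 x r t) => //.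
    - by apply: gapI => //; rewrite e_sym.
    - rewrite /attached in_four !negb_or npt nqt (eq_sym t r) nrt (eq_sym t x) nxt.
      by rewrite (e_sym t r) rt !orbT.
    - by rewrite in_four eqxx !orbT.
    - move=> v; rewrite inE => /and3P[vs vx vo]; split=> //.
      have [v1 v2 /and4P[v3 v4 v5 v6]] := out v vo.
      by rewrite in_four !negb_or v1 v3 v4 v5.
  have Y1 : (#|Y| <= 1)%N.
    apply: (card1 y t r) => //.
    - by apply: gapI => //; rewrite e_sym.
    - rewrite /attached in_four !negb_or npr nqr nrt (eq_sym r y) nyr.
      by rewrite rt !orbT.
    - by rewrite in_four eqxx !orbT.
    - move=> v; rewrite inE => /and3P[vs vx vo]; split=> //.
      have [v1 v2 /and4P[v3 v4 v5 v6]] := out v vo.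
      by rewrite in_four !negb_or v2 v3 v4 v6.
  have cover : s \subset (x |: (y |: four p q r t)) :|: (X :|: Y).
    apply/subsetP=> v vs; rewrite in_setU; case: (boolP (v \in _ |: _)) => //= vo.
    have [v1 v2 _] := out v vo.
    have vm : v \notin four p q r t.
      by move: vo; rewrite in_setU1 in_setU1 !negb_or => /and3P[].
    have va : ~~ attached p q r t v.
      apply/negP=> va; apply: (attached_three gp xs ys vs xa ya va) => //.
        by rewrite eq_sym.
      by rewrite eq_sym.
    have [w ws [vw wa]] := nbr v vs vm va.
    rewrite !inE; case: (eqVneq w x) => [wx|wx].
      by rewrite -!wx vs vw /=; move: vo; rewrite !inE wx => ->.
    have wy : w = y.
      apply/eqP; apply: contraT => wy; exfalso.
      by apply: (attached_three gp xs ys ws xa ya wa); rewrite // eq_sym.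
    by apply/orP; right; rewrite vs -wy vw /=; move: vo; rewrite !inE wy => ->.
  have six : #|x |: (y |: four p q r t)| = 6%N.
    by rewrite cardsU1 cardsU1 m4 in_setU1 (eq_sym x) (negbTE yx) xm ym.
  suff : (#|s| <= 8)%N by rewrite leqNgt s9.
  apply: leq_trans (subset_leq_card cover) _; apply: leq_trans (leq_card_setU _ _) _.
  rewrite six (leq_add2l 6 _ 2); apply: leq_trans (leq_card_setU _ _) _.
  exact: leq_add X1 Y1.
have only v : attached p q r t v -> v \in s -> v = x.
  by move=> va vs; have := nex v; rewrite vs va /= negbK => /eqP.
have sub v : v \in s -> v \notin four p q r t -> v != x -> e v x.
  move=> vs vm vx; have va : ~~ attached p q r t v.
    by apply: contraNN vx => va; apply/eqP/only.
  by have [w ws [vw /only wx]] := nbr v vs vm va; rewrite -wx.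
have [v vs vm] : exists2 v, v \in s & v \notin x |: four p q r t.
  apply/subsetPn; apply: contraL s9 => /subset_leq_card.
  by rewrite cardsU1 xm m4 -leqNgt => /leq_trans; apply.
have /norP[vx v4] : ~~ ((v == x) || (v \in four p q r t)) by rewrite -in_setU1.
have vonly w : w \in s -> e v w -> w = x.
  move=> ws vw; have va : ~~ attached p q r t v.
    by apply: contraNN vx => va; apply/eqP/only.
  have [wm|wm] := boolP (w \in four p q r t).
    have [_ /setP/(_ w)] := unattachedP v4 va.
    by rewrite mem_nb wm vw inE.
  apply: (only w _ ws); apply: contraT => wa.
  by have := unattached_stable gp vs ws v4 wm va wa; rewrite vw.
have /orP[d|d] := nonvan_link e_sym e_irr sh xs.
  have vsx : v \in s :\ x by rewrite in_setD1 vx.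
  have [w] := nonvan_nonisolated e_sym e_irr d vsx.
  by rewrite in_setD1 => /andP[wx ws] /(vonly w ws) wE; rewrite wE eqxx in wx.
have := double_pred_gt3 h3 (nonvan_card e_sym e_irr d); rewrite ltnNge => /negP; apply.
apply: (@leq_trans #|four p q r t :\ r|).
  apply: subset_leq_card; apply/subsetP=> w.
  rewrite in_setD in_setD1 mem_nb => /and3P[wN wx ws].
  rewrite ws /= in wN; rewrite in_setD1; apply/andP; split.
    by apply: contraNneq wN => ->.
  by apply: contraNT wN => wm; rewrite e_sym; apply: sub.
by have := cardsD1 r (four p q r t); rewrite m4 in_four eqxx !orbT add1n => -[<-].
Qed.

End LinearStrand.

(** * Subadditivity for induced subgraphs *)
Lemma nonvan_subadd3 s h a b : nonvan s h -> #|s| = (a + b + h)%N ->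
  (b <= 3)%N -> exists2 k, reach s b k & reach s a (h - k).
Proof.
move=> sh sE b3.
have top : reach s (a + b) h by exact: reach_nonvan.
case: a => [|a] in sE top *.
  exists h; last by rewrite subnn; apply: reach00.
  exact: reach_nonvan.
case: b b3 => [|[|[|[|//]]]] _ in sE top *.
- exists 0%N; first exact: reach00.
  by rewrite subn0; rewrite addn0 in top.
- exists 1%N; last by rewrite subn1; apply: reach_edge; rewrite // -addn1.
  apply: (reach_pos e_irr (h := h - a.+1)); apply: (reach_drop e_sym e_irr).
  by rewrite addnC.
- rewrite addn2 in top; have [d|d] := reach_cherry e_sym e_irr top.
    exists 1%N; last by rewrite subn1.
    apply: (reach_pos e_irr (h := h - a.+1)); apply: (reach_drop e_sym e_irr).
    by rewrite add2n.
  exists 2%N; first by apply: (reach_diag e_sym e_irr) d.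
  by apply: (reach_drop e_sym e_irr); rewrite addn2.
have [d3|nd3] := boolp.pselect (reach s 3 3).
  by exists 3%N; last exact: reach_drop.
rewrite addn3 in top; have [d|d] := reach_cherry e_sym e_irr top; last first.
  by case: nd3; apply: (reach_diag e_sym e_irr) d.
have [d2|nd2] := boolp.pselect (reach s 3 2).
  exists 2%N => //; have := reach_edge e_sym e_irr d.
  by rewrite -subn2; case: (h) => [|[|?]].
exists 1%N.
  apply: (reach_pos e_irr (h := h - a.+1)); apply: (reach_drop e_sym e_irr).
  by rewrite add3n.
have d0 : reach s a.+1 0.
  apply: (reach_le (leq0n (h - 3))); apply: (reach_drop e_sym e_irr).
  by rewrite addn3.
have [h2|h3] := leqP h 2.
  by apply: (reach_le _ (reach_pos e_irr d0)); lia.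
have gf : gapfree e s.
  apply: boolp.contrapT => /not_gapfree[p [q [r [t [ms [_ _ _ m2 m4]]]]]].
  by apply: nd2; apply: (matching_grow e_sym e_irr sh ms m2 m4); lia.
rewrite subn1; apply: (gapfree_reach (b := 2) e_sym e_irr gf (subxx s) sh) => //; lia.
Qed.

(** For [b = 4] and [a <= 3] the roles of [a] and [b] are exchanged.  For [4 <= a],
any induced matching met on the way has at least 4 edges and so realises the
largest value in degree 4, and the vertex set is large enough for [gap_absurd] and
[gapfree_reach]. *)
Lemma nonvan_subadd4 s h a b : nonvan s h -> #|s| = (a + b + h)%N ->
  (b <= 4)%N -> exists2 k, reach s b k & reach s a (h - k).
Proof.
move=> sh sE; rewrite leq_eqVlt => /predU1P[b4|]; last exact: nonvan_subadd3.
rewrite b4 in sE *.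
have [a3|a4] := leqP a 3.
  have [|k ka kb] := nonvan_subadd3 (a := 4) (b := a) sh _ a3; first lia.
  exists (h - k)%N => //; apply: (reach_le _ ka); lia.
have top : reach s (a + 4) h by exact: reach_nonvan.
have drop4 : reach s 4 (h - a) by apply: (reach_drop e_sym e_irr); rewrite addnC.
have [d4|nd4] := boolp.pselect (reach s 4 4).
  by exists 4%N; last exact: reach_drop.
rewrite addn4 in top; have [d|d] := reach_cherry e_sym e_irr top; last first.
  by case: nd4; apply: (reach_diag e_sym e_irr) d.
have [d'|d'] := reach_cherry e_sym e_irr d; last first.
  by case: nd4; apply: (reach_diag e_sym e_irr) d'; lia.
have [d2|nd2] := boolp.pselect (reach s 4 2).
  by exists 2%N => //; rewrite subn2.
exists 1%N; first exact: (reach_pos e_irr drop4).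
have [h2|h3] := leqP h 2.
  case: a a4 {sE top drop4 d} d' => // a _ /(reach_pos e_irr).
  by apply: reach_le; lia.
have gf : gapfree e s.
  apply: boolp.contrapT => /not_gapfree[p [q [r [t gp]]]].
  by apply: (gap_absurd sh nd2 _ h3 _ gp); lia.
rewrite subn1; apply: (gapfree_reach (b := 3) e_sym e_irr gf (subxx s) sh) => //; lia.
Qed.

End Gaps.

(** * The Koszul complex and its multidegrees *)
Section Coefficients.
Variables (K : fieldType) (n : nat).
Local Notation S := {mpoly K[n]}.
Implicit Types (f g : S) (m : 'X_{1..n}).

Lemma coef_sign k f m : ((-1) ^+ k * f)@_m = (-1) ^+ k * f@_m.
Proof.
by rewrite -signr_odd -[in RHS]signr_odd !mulr_sign; case: odd; rewrite ?mcoeffN.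
Qed.

Lemma coef_mulX t f m :
  ('X_t * f)@_m = if (0 < m t)%N then f@_(m - U_(t)) else 0.
Proof.
case: ifPn => mt.
  rewrite -{1}(submK (m := U_(t)%MM) (m' := m)) ?lep1mP -?lt0n //.
  by rewrite addmC mulrC mcoeffMX.
rewrite mcoeffM big1 // => -[a b] /= /eqP mE; rewrite mcoeffX.
case: eqP => [ta|_]; last by rewrite mul0r.
by have := congr1 (fun k : 'X_{1..n} => k t) mE; rewrite mnmDE -ta mnm1E eqxx; lia.
Qed.

Definition poly_of (N : nat) (F : 'X_{1..n} -> K) : S :=
  \sum_(m : 'X_{1..n < N}) F m *: 'X_[m].

Lemma coef_poly_of N F m : (mdeg m < N)%N -> (poly_of N F)@_m = F m.
Proof. exact: mcoeff_mpoly. Qed.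

Lemma coef_poly_of_out N F m : (N <= mdeg m)%N -> (poly_of N F)@_m = 0.
Proof.
move=> Nm; rewrite raddf_sum big1 //= => i _; rewrite mcoeffZ mcoeffX.
case: eqP => [im|]; last by rewrite mulr0.
by have := bmdeg i; rewrite im ltnNge Nm.
Qed.

Definition pfilter (P : pred 'X_{1..n}) f : S :=
  poly_of (msize f) (fun m => if P m then f@_m else 0).

Lemma coef_pfilter P f m : (pfilter P f)@_m = if P m then f@_m else 0.
Proof.
have [lt|ge] := ltnP (mdeg m) (msize f); first by rewrite coef_poly_of.
rewrite coef_poly_of_out //; case: ifP => // _.
by apply/esym/eqP; rewrite mcoeff_eq0; apply: msize_mdeg_ge.
Qed.

Lemma pfilter_mul (P Q : pred 'X_{1..n}) f g :
  (forall a b, b \in msupp g -> P a = Q (a + b)%MM) ->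
  pfilter P f * g = pfilter Q (f * g).
Proof.
move=> PQ; apply/mpolyP=> m; rewrite coef_pfilter !mcoeffM.
have term (k : 'X_{1..n < (mdeg m).+1, (mdeg m).+1}) : m == (k.1 + k.2)%MM ->
    (pfilter P f)@_k.1 * g@_k.2 = if Q m then f@_k.1 * g@_k.2 else 0.
  move=> /eqP mE; rewrite coef_pfilter.
  have [g0|] := eqVneq g@_k.2 0; first by rewrite g0 !mulr0; case: ifP.
  by rewrite -mcoeff_msupp => /PQ->; rewrite -mE; case: ifP; rewrite ?mul0r.
rewrite (eq_bigr _ term); case: ifP => // _; exact: big1.
Qed.

Lemma pfilterB P f g : pfilter P (f - g) = pfilter P f - pfilter P g.
Proof.
apply/mpolyP=> m; rewrite mcoeffB !coef_pfilter mcoeffB.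
by case: ifP; rewrite ?subrr.
Qed.

End Coefficients.

Section SetMonomials.
Variable n : nat.
Implicit Types (T U : {set 'I_n}) (m a : 'X_{1..n}).

Definition mset T : 'X_{1..n} := [multinom (i \in T : nat) | i < n].
Definition msup m : {set 'I_n} := [set i | (0 < m i)%N].

Lemma msetE T i : mset T i = (i \in T). Proof. exact: mnmE. Qed.

Lemma mdeg_mset T : mdeg (mset T) = #|T|.
Proof.
rewrite mdegE -sum1_card [RHS]big_mkcond /=; apply: eq_bigr => i _.
by rewrite msetE; case: (i \in T).
Qed.

Lemma mset_le T m : (mset T <= m)%MM = (T \subset msup m).
Proof.
apply/mnm_lepP/subsetP=> [h i iT|h i].
  by rewrite inE; have := h i; rewrite msetE iT.
by rewrite msetE; case: (boolP (i \in T)) => // /h; rewrite inE.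
Qed.

Lemma msup_add T m : T \subset msup (m + mset T).
Proof. by rewrite -mset_le addmC lem_addr. Qed.

Lemma mset_setU1 T t : t \notin T -> mset (t |: T) = (mset T + U_(t))%MM.
Proof.
move=> tT; apply/mnmP=> i; rewrite mnmDE !msetE mnm1E in_setU1 eq_sym.
by case: (eqVneq t i) => [<-|] /=; rewrite ?(negbTE tT) ?addn0.
Qed.

Lemma mdeg_sub_mset T m : T \subset msup m ->
  (mdeg (m - mset T) + #|T|)%N = mdeg m.
Proof. by rewrite -mset_le => Tm; rewrite -mdeg_mset -mdegD submK. Qed.

End SetMonomials.

Section Koszul.
Variables (K : fieldType) (n : nat).
Local Notation S := {mpoly K[n]}.
Implicit Types (c b : {set 'I_n} -> S) (T U : {set 'I_n}) (m : 'X_{1..n}).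

(** A chain assigns to [T] the coefficient of the exterior monomial on [T]. *)
Definition koszul c T : S :=
  \sum_(t | t \notin T) (-1) ^+ nbelow t T * ('X_t * c (t |: T)).

Lemma eq_koszul c b T : (forall t, t \notin T -> c (t |: T) = b (t |: T)) ->
  koszul c T = koszul b T.
Proof. by move=> cb; apply: eq_bigr => t tT; rewrite cb. Qed.

Lemma koszul_sum (I : finType) (c : I -> {set 'I_n} -> S) (a : I -> S) T :
  koszul (fun T' => \sum_i c i T' * a i) T = \sum_i koszul (c i) T * a i.
Proof.
rewrite /koszul (eq_bigr (fun i => \sum_(t | t \notin T)
  (-1) ^+ nbelow t T * ('X_t * c i (t |: T)) * a i)); last first.
  by move=> i _; rewrite mulr_suml.
rewrite exchange_big /=; apply: eq_bigr => t _; rewrite !mulr_sumr.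
by apply: eq_bigr => i _; rewrite !mulrA.
Qed.

Lemma koszulB c b T : koszul (fun T' => c T' - b T') T = koszul c T - koszul b T.
Proof. by rewrite -sumrB; apply: eq_bigr => t _; rewrite !mulrBr. Qed.

Lemma nbelow_setU1 (t u : 'I_n) T : t \notin T ->
  nbelow u (t |: T) = ((t < u)%N + nbelow u T)%N.
Proof. by move=> tT; rewrite (nbelow_setD1 u (setU11 t T)) setU1K. Qed.

(** The two orders of adding [t] and [u] to [T] have opposite signs. *)
Lemma koszulK c T : koszul (koszul c) T = 0.
Proof.
rewrite {1}/koszul (eq_bigr (fun t => \sum_(u | u \notin t |: T)
   (-1) ^+ nbelow t T * ('X_t * ((-1) ^+ nbelow u (t |: T) *
      ('X_u * c (u |: (t |: T))))))); last first.
  by move=> t _; rewrite !mulr_sumr.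
rewrite big_mkcond (eq_bigr (fun t => \sum_(u | [&& t \notin T, u \notin T & u != t])
  (-1) ^+ nbelow t T * ('X_t * ((-1) ^+ nbelow u (t |: T) *
     ('X_u * c (u |: (t |: T))))))); last first.
  move=> t _; case: (boolP (t \in T)) => /= tT; first by rewrite big_pred0.
  by apply: eq_bigl => u; rewrite !inE negb_or andbC.
apply: sum_antisym => t u /and3P[tT uT ut]; split.
- by rewrite uT tT eq_sym.
- by rewrite eq_sym.
rewrite setUCA; set x := c _.
have E (y z s1 s2 : S) : s1 * (y * (s2 * (z * x))) = s1 * s2 * (y * (z * x)).
  by rewrite (mulrCA y) [LHS]mulrA.
rewrite !E (mulrCA 'X_u 'X_t) -mulNr; congr (_ * _).
rewrite !nbelow_setU1 //.
have -> : (u < t)%N = ~~ (t < u)%N by rewrite -leqNgt ltn_neqAle andb_idl // eq_sym.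
move: (nbelow t T) (nbelow u T) => i k; rewrite -!exprD.
case: (t < u)%N; rewrite /= ?add0n ?add1n addnC ?addSn ?addnS ?exprS ?mulN1r ?opprK //.
Qed.

(** Pure Koszul degree [p] and total degree [j], for chains with coefficients in
the free module generated in degree [s]. *)
Definition graded (p j s : nat) c : Prop := forall T m, (c T)@_m != 0 ->
  #|T| = p /\ (mdeg m + #|T| + s = j)%N.

Lemma koszul_neq0 c T m : (koszul c T)@_m != 0 ->
  exists t, [/\ t \notin T, (0 < m t)%N & (c (t |: T))@_(m - U_(t)) != 0].
Proof.
move=> nz; apply: boolp.contrapT => nex; case/negP: nz.
rewrite raddf_sum big1 //= => t tT; rewrite coef_sign coef_mulX.
case: ifP => mt; last by rewrite mulr0.
have [->|nz] := eqVneq (c (t |: T))@_(m - U_(t)) 0; first by rewrite mulr0.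
by case: nex; exists t.
Qed.

Lemma koszul_graded p j s c : graded p.+1 j s c -> graded p j s (koszul c).
Proof.
move=> hc T m /koszul_neq0[t [tT mt /hc]]; rewrite cardsU1 tT => -[Tp mE].
have := mdegD (m - U_(t)) U_(t); rewrite submK ?lep1mP -?lt0n // mdeg1; lia.
Qed.

(** In multidegree [a] with support [A], the coefficient on [T] is read on the
complement [U] of [T] in [A], which turns adding to [T] into removing from [U].
The signs then count elements of [A :\: U] instead of [U]; [twist] is the change
of basis that corrects them. *)
Definition twist (A U : {set 'I_n}) : nat := \sum_(u in U) nbelow u A.

Definition mdpart c (a : 'X_{1..n}) U : K :=
  (-1) ^+ twist (msup a) U * (c (msup a :\: U))@_(a - mset (msup a :\: U)).

Lemma nbelow_setDI u (A U : {set 'I_n}) : U \subset A ->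
  nbelow u A = (nbelow u U + nbelow u (A :\: U))%N.
Proof.
move=> /setIidPr UA; rewrite /nbelow -(cardsID U).
congr addn; apply: eq_card => s; rewrite !inE.
  by rewrite andbAC; congr (_ && _); rewrite -{2}UA inE.
by rewrite andbA.
Qed.

Lemma mdpart_koszul c a U : U \subset msup a -> mdpart (koszul c) a U = delta (mdpart c a) U.
Proof.
move=> Ua; set A := msup a; rewrite /mdpart -/A /delta raddf_sum /= mulr_sumr.
rewrite (bigID (fun t => t \in U)) /= [X in _ + X]big1 ?addr0 => [|t /andP[tT tU]].
  rewrite (eq_bigl (fun t => t \in U)) => [|t]; last first.
    by rewrite /= inE; case: (t \in U); rewrite ?andbF.
  apply: eq_bigr => u uU.
  have uA := subsetP Ua _ uU; have au : (0 < a u)%N by move: uA; rewrite inE.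
  have uT : u \notin A :\: U by rewrite inE uU.
  have ATu : A :\: (U :\ u) = u |: (A :\: U).
    apply/setP=> s; rewrite in_setU1 !in_setD in_set1; case: (eqVneq s u) => [->|] //=.
  rewrite coef_sign coef_mulX mnmBE msetE (negbTE uT) subn0 au submDA -mset_setU1 //.
  rewrite -ATu; set x := (c _)@_ _.
  rewrite /twist (big_setD1 u) //= (nbelow_setDI u Ua) !mulrA; congr (_ * _).
  rewrite -!exprD -signr_odd -[RHS]signr_odd; congr (_ ^+ _).
  rewrite !oddD; move: (odd (nbelow u U)) (odd (nbelow u (A :\: U))) => x1 x2.
  by case: x1; case: x2; case: (odd _).
rewrite coef_sign coef_mulX mnmBE.
have -> : a t = 0%N by move: tT; rewrite inE tU /= inE -eqn0Ngt => /eqP.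
by rewrite mulr0 mulr0.
Qed.

Lemma coef_mdpart c T m : let a := (m + mset T)%MM in
  (c T)@_m = (-1) ^+ twist (msup a) (msup a :\: T) * mdpart c a (msup a :\: T).
Proof.
move=> a; rewrite /mdpart signrMK; have /setIidPr := msup_add T m; rewrite -/a; set A := msup _ => AT.
have -> : A :\: (A :\: T) = T by rewrite setDDr setDv set0U AT.
by rewrite addmK.
Qed.

Section Modulo.
Variable J : pred 'X_{1..n}.
Hypothesis J_up : forall m1 m2, (m1 <= m2)%MM -> J m1 -> J m2.

(** The complements [U] of the sets [T] for which the monomial of multidegree [a]
on [T] survives modulo [J]. *)
Definition mdfaces (a : 'X_{1..n}) : {pred {set 'I_n}} :=
  fun U => (U \subset msup a) && ~~ J (a - mset (msup a :\: U))%MM.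

Lemma mdfaces_sub a U : U \in mdfaces a -> U \subset msup a.
Proof. by case/andP. Qed.

Lemma mdfaces_setD1 a U u : U \in mdfaces a -> U :\ u \in mdfaces a.
Proof.
case/andP=> Ua JU; apply/andP; split; first exact: subset_trans (subD1set _ _) Ua.
apply: contraNN JU; apply: J_up; apply/mnm_lepP=> i.
rewrite !mnmBE !msetE leq_sub2l // !inE; case: (boolP (i \in U)) => //=.
by rewrite andbF.
Qed.

Lemma mdfaces_coef m T : ~~ J m -> msup (m + mset T) :\: T \in mdfaces (m + mset T).
Proof.
move=> Jm; apply/andP; split; first exact: subsetDl.
have /setIidPr AT := msup_add T m.
by rewrite setDDr setDv set0U AT addmK.
Qed.

Lemma card_msupD m T : (#|msup (m + mset T) :\: T| + #|T|)%N = #|msup (m + mset T)|.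
Proof. by rewrite addnC -(cardsID T (msup _)) (setIidPr (msup_add T m)). Qed.

(** Multidegrees are independent of each other, so the parts of a chain can be
prescribed. *)
Lemma exists_mdparts p j s (G : 'X_{1..n} -> {set 'I_n} -> K) :
  exists b, [/\ graded p j s b, forall T m, J m -> (b T)@_m = 0
    & forall a U, U \in mdfaces a -> (#|U| + p)%N = #|msup a| -> (mdeg a + s = j)%N ->
      mdpart b a U = G a U].
Proof.
pose C T m := [&& #|T| == p, (mdeg m + #|T| + s == j)%N & ~~ J m].
pose A T m := msup (m + mset T).
pose b T := poly_of j.+1 (fun m => if C T m then
   (-1) ^+ twist (A T m) (A T m :\: T) * G (m + mset T)%MM (A T m :\: T) else 0).
have bE T m : (b T)@_m = if C T m then
   (-1) ^+ twist (A T m) (A T m :\: T) * G (m + mset T)%MM (A T m :\: T) else 0.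
  have [lt|ge] := ltnP (mdeg m) j.+1; first by rewrite coef_poly_of.
  rewrite coef_poly_of_out //; case: ifP => // /and3P[_ /eqP mE _]; lia.
have hb : graded p j s b.
  move=> T m; rewrite bE; case: ifP => [/and3P[/eqP ? /eqP ? _] _|]; first by [].
  by rewrite eqxx.
exists b; split=> //.
- by move=> T m Jm; rewrite bE /C Jm !andbF.
- move=> a U /andP[Ua JU] Up aj; rewrite /mdpart; set T := msup a :\: U.
  have Ta : T \subset msup a by apply: subsetDl.
  have aE : (a - mset T + mset T)%MM = a by rewrite submK // mset_le.
  have AU : msup a :\: T = U by rewrite setDDr setDv set0U (setIidPr Ua).
  have Tp : #|T| = p.
    by have := cardsID U (msup a); rewrite (setIidPr Ua) -/T; lia.
  rewrite bE ifT; first by rewrite /A aE AU signrMK.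
  by rewrite /C mdeg_sub_mset // aj Tp !eqxx JU.
Qed.

(** A chain is a boundary modulo [J] as soon as each multidegree part is. *)
Lemma koszul_solve p j s c : graded p j s c ->
  (forall a, (mdeg a + s = j)%N ->
    exists g, forall U, U \in mdfaces a -> (#|U| + p)%N = #|msup a| ->
      mdpart c a U = delta g U) ->
  exists b, [/\ graded p.+1 j s b, forall T m, J m -> (b T)@_m = 0
     & forall T m, ~~ J m -> (c T)@_m = (koszul b T)@_m].
Proof.
move=> hc ex.
have [a|G GP] := boolp.choice (P := fun a g => (mdeg a + s = j)%N ->
    forall U, U \in mdfaces a -> (#|U| + p)%N = #|msup a| -> mdpart c a U = delta g U).
  have [/ex[g gE]|ne] := eqVneq (mdeg a + s)%N j; first by exists g.
  by exists (fun _ => 0) => e; rewrite e eqxx in ne.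
have [b [hb bJ bG]] := exists_mdparts p.+1 j s G.
exists b; split=> // T m Jm.
have [/andP[/eqP Tp /eqP mE]|ne] :=
  boolP ((#|T| == p) && (mdeg m + #|T| + s == j)%N); last first.
  have [->|/hc[e1 e2]] := eqVneq (c T)@_m 0; last first.
    by case/negP: ne; apply/andP; split; apply/eqP.
  apply/esym/eqP; apply: contraNT ne => /(koszul_graded hb)[e1 e2].
  by apply/andP; split; apply/eqP.
rewrite [LHS]coef_mdpart [RHS]coef_mdpart; congr (_ * _).
have fm := mdfaces_coef T Jm; have cm := card_msupD m T.
set a := (m + mset T)%MM in fm cm *; set U := _ :\: T in fm cm *.
have aj : (mdeg a + s = j)%N by rewrite mdegD mdeg_mset.
rewrite (GP a) //; last by rewrite -Tp.
rewrite mdpart_koszul; last exact: mdfaces_sub fm.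
apply: eq_delta => u uU; rewrite bG //; first exact: mdfaces_setD1.
by rewrite -cm Tp (cardsD1 u U) uU; lia.
Qed.

End Modulo.

(** Modulo nothing, all subsets of the support are allowed, and any variable in the
support is an apex.  Only multidegree 0 escapes; it is excluded by the
vanishing of the constant coefficient. *)
Lemma koszul_exact p j s c : graded p j s c ->
  (forall T, koszul c T = 0) -> (c set0)@_0%MM = 0 ->
  exists b, graded p.+1 j s b /\ forall T, koszul b T = c T.
Proof.
move=> hc cyc c0.
have [||b [hb _ bc]] := @koszul_solve pred0 _ p j s c hc.
- by [].
- move=> a aj; have [a0|[t ta]] := set_0Vmem (msup a).
    have {a0}a0 : a = 0%MM.
      apply/mnmP=> i; rewrite mnm0E; move/setP/(_ i): a0; rewrite !inE.
      by case: (a i).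
    exists (fun _ => 0) => U; rewrite a0 => /mdfaces_sub.
    have -> : msup (0%MM : 'X_{1..n}) = set0.
      by apply/setP=> i; rewrite !inE mnm0E.
    rewrite subset0 => /eqP -> _; rewrite /delta big_set0 /mdpart.
    have -> : msup (0%MM : 'X_{1..n}) = set0.
      by apply/setP=> i; rewrite !inE mnm0E.
    have -> : (0 - mset (set0 :\: set0 : {set 'I_n}) = 0)%MM.
      by apply/mnmP=> i; rewrite mnmBE mnm0E sub0n.
    by rewrite setDv c0 mulr0.
  have [pa|pa] := leqP p #|msup a|; last first.
    by exists (fun _ => 0) => U _ Up; lia.
  have [||g gE] := @acyclic_cone K n (mdfaces pred0 a) t (#|msup a| - p) _ (mdpart c a).
  - move=> U /andP[Ua _]; apply/andP; split=> //.
    by rewrite subUset sub1set ta.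
  - move=> U /mdfaces_sub Ua _; rewrite -mdpart_koszul // /mdpart cyc mcoeff0 mulr0 //.
  by exists g => U UF Up; apply: gE => //; lia.
by exists b; split=> // T; apply/mpolyP=> m; rewrite bc.
Qed.

End Koszul.

(** * Double complexes with exact rows and columns *)
Section ExactAt.
Variables (C : nat -> zmodType) (inC : forall i, C i -> Prop).
Variable d : forall i, C i.+1 -> C i.

Definition is_cycle (i : nat) : C i -> Prop :=
  match i with 0%N => fun _ => True | i'.+1 => fun c => d c = 0 end.

Definition exact_at (i : nat) : Prop :=
  forall c : C i, inC c -> is_cycle c -> exists b, inC b /\ d b = c.
End ExactAt.

Record exact_rows (X : nat -> nat -> zmodType) (inX : forall p q, X p q -> Prop)
    (A : nat -> zmodType) (inA : forall p, A p -> Prop)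
    (d : forall p q, X p q.+1 -> X p q) (eps : forall p, X p 0%N -> A p) : Prop :=
  ExactRows {
    row_dB : forall p q, {morph @d p q : x y / x - y};
    row_epsB : forall p, {morph @eps p : x y / x - y};
    row_d_in : forall p q x, inX p q.+1 x -> inX p q (d p q x);
    row_eps_in : forall p x, inX p 0%N x -> inA p (eps p x);
    row_dd : forall p q x, d p q (d p q.+1 x) = 0;
    row_eps_d : forall p x, eps p (d p 0%N x) = 0;
    row_exact : forall p q x, inX p q.+1 x -> d p q x = 0 ->
      exists y, inX p q.+2 y /\ d p q.+1 y = x;
    row_exact0 : forall p x, inX p 0%N x -> eps p x = 0 ->
      exists y, inX p 1%N y /\ d p 0%N y = x;
    row_onto : forall p a, inA p a -> exists x, inX p 0%N x /\ eps p x = a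
  }.

Section Zigzag.
Variables (X : nat -> nat -> zmodType) (inX : forall p q, X p q -> Prop).
Variables (A : nat -> zmodType) (inA : forall p, A p -> Prop).
Variables (B : nat -> zmodType) (inB : forall q, B q -> Prop).
Variables (dh : forall p q, X p q.+1 -> X p q) (eA : forall p, X p 0%N -> A p).
Variables (dv : forall q p, X p.+1 q -> X p q) (eB : forall q, X 0%N q -> B q).
Variables (dA : forall p, A p.+1 -> A p) (dB : forall q, B q.+1 -> B q).
Hypothesis rows : exact_rows inX inA dh eA.
Hypothesis cols :
  exact_rows (X := fun q p => X p q) (fun q p => @inX p q) inB dv eB.
Hypothesis inX_sub : forall p q (x y : X p q), inX x -> inX y -> inX (x - y).
Hypothesis comm : forall p q (x : X p.+1 q.+1), dv (dh x) = dh (dv x).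
Hypothesis comm_A : forall p (x : X p.+1 0%N), eA (dv x) = dA (eA x).
Hypothesis comm_B : forall q (x : X 0%N q.+1), eB (dh x) = dB (eB x).

(** The horizontal image of [x] is a vertical cycle; in row 0, where it is replaced
by the image in [A], the latter is a cycle of [A]. *)
Let liftable p q : X p q -> Prop :=
  match q return X p q -> Prop with
  | 0%N => match p return X p 0%N -> Prop with
           | 0%N => fun _ => True
           | p'.+1 => fun x => dA (eA x) = 0 end
  | q'.+1 => match p return X p q'.+1 -> Prop with
           | 0%N => fun x => eB (dh x) = 0
           | p'.+1 => fun x => dv (dh x) = 0 end
  end.

(** Induction on the row: the horizontal differential of [x] is a vertical cycle,
hence the vertical differential of some [y] one step further along the
diagonal, to which the induction applies.  The diagonal ends in [A], where the
exactness assumption enters. *)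
Lemma zigzag_split q : forall p, exact_at inA dA (p + q) ->
  forall x : X p q, inX x -> liftable x ->
  exists (z : X p.+1 q) (w : X p q.+1), [/\ inX z, inX w & x = dv z + dh w].
Proof.
elim: q => [|q IH] p exA x xX lx.
  rewrite addn0 in exA.
  have [|a [aA aE]] := exA (eA x) (row_eps_in rows xX).
    by case: p {exA xX} x lx => [|p] x lx.
  have [z [zX zE]] := row_onto rows aA.
  have yX : inX (x - dv z) by apply: inX_sub => //; apply: (row_d_in cols).
  have [|w [wX wE]] := row_exact0 rows yX.
    by rewrite (row_epsB rows) comm_A zE aE subrr.
  by exists z, w; split; rewrite // wE addrC subrK.
have [y [yX yE]] : exists y : X p.+1 q, inX y /\ dv y = dh x.
  have dX := row_d_in rows xX.
  case: p {IH exA} x xX lx dX => [|p] x xX lx dX.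
    exact: (row_exact0 cols dX lx).
  exact: (row_exact cols dX lx).
have [||z [w [zX wX yzw]]] := IH p.+1 _ y yX; first by rewrite addSnnS.
  case: q {IH exA} x xX lx y yX yE => [|q] x xX lx y yX yE.
    by rewrite /= -comm_A yE (row_eps_d rows).
  by rewrite /= comm yE (row_dd rows).
have xwX : inX (x - dv w) by apply: inX_sub => //; apply: (row_d_in cols).
have [|v [vX vE]] := row_exact rows xwX.
  by rewrite (row_dB rows) -comm -yE -(row_dB cols) yzw addrK (row_dd cols).
by exists w, v; split; rewrite // vE addrC subrK.
Qed.

Lemma zigzag i : exact_at inA dA i -> exact_at inB dB i.
Proof.
move=> exA u uB cu; have [x [xX xE]] := row_onto cols uB.
have [|z [w [zX wX xzw]]] := zigzag_split (q := i) (p := 0) exA xX.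
  by case: i {exA} u uB cu x xX xE => [|i] u uB cu x xX xE //=; rewrite comm_B xE.
exists (eB w); split; first exact: (row_eps_in cols).
rewrite -comm_B -xE; have -> : dh w = x - dv z by rewrite xzw addrC addKr.
by rewrite (row_epsB cols) (row_eps_d cols) subr0.
Qed.
End Zigzag.

(** * The Koszul complex of the edge ring *)
Section EdgeMonomials.
Variables (K : fieldType) (n : nat) (e : rel 'I_n).
Hypothesis e_irr : irreflexive e.
Local Notation S := {mpoly K[n]}.

Definition edge_mnm : pred 'X_{1..n} :=
  fun m => [exists x, exists y, [&& e x y, (0 < m x)%N & (0 < m y)%N]].

Lemma edge_mnmP (m : 'X_{1..n}) :
  reflect (exists x y, [/\ e x y, (0 < m x)%N & (0 < m y)%N]) (edge_mnm m).
Proof.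
apply: (iffP existsP) => [[x /existsP[y /and3P[xy mx my]]]|[x [y [xy mx my]]]].
  by exists x, y.
by exists x; apply/existsP; exists y; rewrite xy mx my.
Qed.

Lemma edge_mnm_up a b : (a <= b)%MM -> edge_mnm a -> edge_mnm b.
Proof.
move=> /mnm_lepP ab /edge_mnmP[x [y [xy ax ay]]]; apply/edge_mnmP; exists x, y.
by split=> //; [apply: leq_trans (ab x)|apply: leq_trans (ab y)].
Qed.

Lemma edge_idealE (f : S) :
  edge_ideal e f <-> forall m, ~~ edge_mnm m -> f@_m = 0.
Proof.
split=> [[c ->] m Jm|f0].
  rewrite raddf_sum big1 //= => x _; rewrite raddf_sum big1 //= => y xy.
  rewrite mulrC -mulrA !coef_mulX; case: ifP => // mx; case: ifP => // my.
  case/edge_mnmP: Jm; exists x, y; split=> //; apply: leq_trans my _.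
  by rewrite mnmBE leq_subr.
apply/edge_idealP; rewrite [f]mpolyE big_seq; apply: rpred_sum => m.
rewrite mcoeff_msupp => fm.
have /edge_mnmP[x [y [xy mx my]]] : edge_mnm m.
  by apply: contraNT fm => /f0 ->.
have mE : m = (m - U_(x) - U_(y) + (U_(x) + U_(y)))%MM.
  apply/mnmP=> i; rewrite !mnmDE !mnmBE !mnm1E.
  have nxy : x != y by apply: contraTneq xy => ->; rewrite e_irr.
  case: (eqVneq x i) => [xi|_]; case: (eqVneq y i) => [yi|_] /=.
  - by rewrite xi yi eqxx in nxy.
  - by rewrite -xi; lia.
  - by rewrite -yi; lia.
  - by lia.
rewrite mE mpolyXD scalerAl; apply: edge_idealb_mul; apply/edge_idealP.
exists (fun i k => ((i == x) && (k == y))%:R); rewrite (bigD1 x) //= (bigD1 y) //=.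
rewrite !eqxx mul1r mpolyXD !big1 ?addr0 // => i ix.
  by apply: big1 => k _; rewrite (negbTE ix) mul0r.
by case/andP: ix => _ /negbTE->; rewrite andbF mul0r.
Qed.

(** Since the edge ideal is spanned by monomials, deleting them gives a normal form
for classes in [S/I]. *)
Definition nf (f : S) : S := pfilter (fun m => ~~ edge_mnm m) f.

Lemma nf_eq (f g : S) : nf f = nf g <-> edge_proj e f = edge_proj e g.
Proof.
rewrite edge_projP edge_idealE; split=> [fg m Jm|fg].
  by have /mpolyP/(_ m) := fg; rewrite !coef_pfilter Jm mcoeffB => ->; rewrite subrr.
apply/mpolyP=> m; rewrite !coef_pfilter; case: ifP => // /fg /eqP.
by rewrite mcoeffB subr_eq0 => /eqP.
Qed.

Lemma nf_id (f : S) : (forall m, edge_mnm m -> f@_m = 0) -> nf f = f.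
Proof.
move=> f0; apply/mpolyP=> m; rewrite coef_pfilter.
by case: ifPn => // /negPn /f0.
Qed.

Lemma koszul_nf (c : {set 'I_n} -> S) T m : ~~ edge_mnm m ->
  (koszul (fun T' => nf (c T')) T)@_m = (koszul c T)@_m.
Proof.
move=> Jm; rewrite !raddf_sum /=; apply: eq_bigr => t _.
rewrite !coef_sign !coef_mulX; case: ifP => // mt; rewrite coef_pfilter ifT //.
by apply: contraNN Jm; apply: edge_mnm_up; apply/mnm_lepP=> i; rewrite mnmBE leq_subr.
Qed.

Lemma edge_mdfaces (a : 'X_{1..n}) : (forall i, (a i <= 1)%N) ->
  mdfaces edge_mnm a =i faces e (msup a).
Proof.
move=> a1 U; apply/andP/andP => -[Ua]; [move=> JU|move/indepP=> iU]; split=> //.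
  apply/indepP=> x y xU yU; apply: contraNN JU => xy; apply/edge_mnmP.
  exists x, y; rewrite !mnmBE !msetE !inE xU yU !subn0; split=> //.
    by move/subsetP/(_ x xU): Ua; rewrite inE.
  by move/subsetP/(_ y yU): Ua; rewrite inE.
apply/edge_mnmP=> -[x [y [xy]]]; rewrite !mnmBE !msetE !inE => mx my.
have inU i : (0 < a i - ((i \notin U) && (0 < a i)))%N -> i \in U.
  by have := a1 i; case: (i \in U) => //=; lia.
by have := iU x y (inU _ mx) (inU _ my); rewrite xy.
Qed.

(** Removing the variable [i], whose exponent is at least 2, does not change the
support, hence not the membership in the edge ideal: [i] is an apex. *)
Lemma edge_mdfaces_acyclic (a : 'X_{1..n}) i h : (1 < a i)%N ->
  acyclic K (mdfaces edge_mnm a) h.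
Proof.
move=> ai; apply: (acyclic_cone (t := i)) => U /andP[Ua JU]; apply/andP; split.
  by rewrite subUset Ua andbT sub1set inE ltnW.
apply: contraNN JU => /edge_mnmP[x [y [xy mx my]]]; apply/edge_mnmP; exists x, y.
have mono (z : 'I_n) : (0 < (a - mset (msup a :\: (i |: U)))%MM z)%N ->
             (0 < (a - mset (msup a :\: U))%MM z)%N.
  rewrite !mnmBE !msetE !inE; case: (eqVneq z i) => [->|] //= _.
  by case: (i \in U); lia.
by split=> //; apply: mono.
Qed.

End EdgeMonomials.

(** * Hochster's formula *)
Section Hochster.
Variables (K : fieldType) (n : nat) (e : rel 'I_n).
Hypothesis e_irr : irreflexive e.
Variables (F : graded_free_res K e) (j : nat).
Local Notation S := {mpoly K[n]}.
Local Notation J := (edge_mnm e).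
Local Notation nf := (nf e).

(** [KF] is the Koszul complex with coefficients in the resolution, with
augmentations [augF] to the Koszul complex [KQ] of [S/I] and [augK] to the
complex [FK], which computes [betti]. *)
Definition KF (p q : nat) : zmodType := {ffun {set 'I_n} -> 'rV[S]_(grank F q)}.
Definition KQ (p : nat) : zmodType := {ffun {set 'I_n} -> S}.
Definition FK (q : nat) : zmodType := 'rV[K]_(grank F q).

Definition inKF p q (c : KF p q) : Prop :=
  forall k, graded p j (gshift k) (fun T => c T 0 k).
Definition inKQ p (a : KQ p) : Prop :=
  graded p j 0 a /\ forall T m, J m -> (a T)@_m = 0.
Definition inFK q (u : FK q) : Prop := forall k, u 0 k != 0 -> gshift k = j.

Definition dF p q (c : KF p q.+1) : KF p q := [ffun T => c T *m gdiff F q].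
Definition dK q p (c : KF p.+1 q) : KF p q :=
  [ffun T => \row_k koszul (fun T' => c T' 0 k) T].
Definition augF p (c : KF p 0) : KQ p := [ffun T => nf ((c T *m gaug F) 0 0)].
Definition augK q (c : KF 0 q) : FK q := map_mx (mcoeff 0%MM) (c set0).
Definition dKQ p (a : KQ p.+1) : KQ p := [ffun T => nf (koszul a T)].
Definition dFK q (u : FK q.+1) : FK q := u *m tor_diff F q.

Lemma inKF_sub p q (x y : KF p q) : inKF x -> inKF y -> inKF (x - y).
Proof.
move=> hx hy k T m; rewrite !ffunE mxE mxE mcoeffB => nz.
have [x0|/hx//] := eqVneq (x T 0 k)@_m 0.
by apply: hy; apply: contraNneq nz => ->; rewrite x0 subrr.
Qed.

(** The component of [w] with total degree [j], when [w] is the value of a chain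
on a set with [t] elements. *)
Definition rowpart q (t : nat) (w : 'rV[S]_(grank F q)) : 'rV[S]_(grank F q) :=
  \row_k pfilter (fun m => mdeg m + t + gshift k == j)%N (w 0 k).

Lemma rowpart_mul q t (w : 'rV[S]_(grank F q.+1)) :
  rowpart t w *m gdiff F q = rowpart t (w *m gdiff F q).
Proof.
apply/rowP=> l; rewrite !mxE; apply/mpolyP=> m.
rewrite coef_pfilter !raddf_sum /=.
transitivity (\sum_k (pfilter (fun m => mdeg m + t + gshift l == j)%N
    (w 0 k * gdiff F q k l))@_m).
  apply: eq_bigr => k _; rewrite mxE; congr (mcoeff m _); apply: pfilter_mul.
  by move=> a b /gdiff_homog <-; rewrite mdegD; congr (_ == _); lia.
case: ifP => mj; first by apply: eq_bigr => k _; rewrite coef_pfilter mj.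
by apply: big1 => k _; rewrite coef_pfilter mj.
Qed.

Lemma rowpart_aug t (w : 'rV[S]_(grank F 0)) :
  (rowpart t w *m gaug F) 0 0
    = pfilter (fun m => mdeg m + t == j)%N ((w *m gaug F) 0 0).
Proof.
rewrite !mxE; apply/mpolyP=> m; rewrite coef_pfilter !raddf_sum /=.
transitivity (\sum_k (pfilter (fun m => mdeg m + t == j)%N
    (w 0 k * gaug F k 0))@_m).
  apply: eq_bigr => k _; rewrite mxE; congr (mcoeff m _); apply: pfilter_mul.
  by move=> a b /gaug_homog <-; rewrite mdegD; congr (_ == _); lia.
case: ifP => mj; first by apply: eq_bigr => k _; rewrite coef_pfilter mj.
by apply: big1 => k _; rewrite coef_pfilter mj.
Qed.

Lemma rowpart_id p q (c : KF p q) (T : {set 'I_n}) : inKF c -> rowpart #|T| (c T) = c T.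
Proof.
move=> hc; apply/rowP=> k; rewrite mxE; apply/mpolyP=> m; rewrite coef_pfilter.
case: ifPn => // ne; apply/esym/eqP; apply: contraNT ne => /hc[_ ->].
by rewrite eqxx.
Qed.

Lemma inKF_out p q (c : KF p q) (T : {set 'I_n}) : inKF c -> #|T| != p -> c T = 0.
Proof.
move=> hc Tp; apply/rowP=> k; rewrite mxE; apply/mpolyP=> m; rewrite mcoeff0.
by apply/eqP; apply: contraNT Tp => /hc[-> _].
Qed.

(** The resolution is exact without regard to degrees; taking the component of the
right degree makes the lifts homogeneous. *)
Lemma lift_rows p q (P : {set 'I_n} -> 'rV[S]_(grank F q) -> Prop) :
  (forall T, exists w, P T w) ->
  exists y : KF p q, inKF y /\ forall T : {set 'I_n}, #|T| = p -> exists2 w, P T w &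
    y T = rowpart #|T| w.
Proof.
move=> /boolp.choice[w wP].
exists [ffun T : {set 'I_n} => if #|T| == p then rowpart #|T| (w T) else 0]; split.
  move=> k T m; rewrite ffunE; case: (eqVneq #|T| p) => Tp; rewrite mxE ?mcoeff0 ?eqxx //.
  by rewrite coef_pfilter; case: ifP => [/eqP mE|]; rewrite ?eqxx.
by move=> T Tp; exists (w T); rewrite // ffunE Tp eqxx.
Qed.

Lemma dF_in p q (x : KF p q.+1) : inKF x -> inKF (dF x).
Proof.
move=> hx l T m; rewrite ffunE -(rowpart_id T hx) rowpart_mul mxE coef_pfilter.
have [Tp|Tp] := eqVneq #|T| p; last first.
  by rewrite (inKF_out hx Tp) mul0mx mxE mcoeff0; case: ifP; rewrite eqxx.
by case: ifP => [/eqP mE|]; rewrite ?eqxx.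
Qed.

Lemma augF_in p (x : KF p 0) : inKF x -> inKQ (augF x).
Proof.
move=> hx; split=> [T m|T m Jm]; last by rewrite ffunE coef_pfilter Jm.
rewrite ffunE -(rowpart_id T hx) rowpart_aug coef_pfilter; case: ifP; rewrite ?eqxx //.
have [Tp|Tp] := eqVneq #|T| p; last first.
  by rewrite (inKF_out hx Tp) mul0mx mxE coef_pfilter mcoeff0; case: ifP; rewrite eqxx.
by rewrite coef_pfilter; case: ifP => [/eqP mE|]; rewrite ?eqxx ?addn0.
Qed.

Lemma rows_exact : exact_rows inKF inKQ dF augF.
Proof.
split.
- by move=> p q x y; apply/ffunP=> T; rewrite !ffunE mulmxBl.
- move=> p x y; apply/ffunP=> T; rewrite !ffunE mulmxBl -pfilterB; congr nf.
  by rewrite mxE [X in _ + X]mxE.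
- exact: dF_in.
- exact: augF_in.
- move=> p q x; apply/ffunP=> T; rewrite !ffunE; apply/(gdiff_exact (g := F)).
  by exists (x T).
- move=> p x; apply/ffunP=> T; rewrite !ffunE.
  have -> : 0 = nf (0 : S).
    by rewrite nf_id // => m _; rewrite mcoeff0.
  apply/nf_eq; rewrite // [RHS](_ : _ = 0).
    by apply/(gaug_exact (g := F)); exists (x T).
  exact: raddf0.
- move=> p q x hx x0.
  have [|y [hy yE]] := @lift_rows p q.+2 (fun T w => w *m gdiff F q.+1 = x T).
    by move=> T; apply/(gdiff_exact (g := F)); move/ffunP/(_ T): x0; rewrite !ffunE.
  exists y; split=> //; apply/ffunP=> T; rewrite ffunE.
  have [Tp|Tp] := eqVneq #|T| p; last by rewrite !(inKF_out _ Tp) ?mul0mx.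
  by have [w wE ->] := yE T Tp; rewrite rowpart_mul wE (rowpart_id T hx).
- move=> p x hx x0.
  have [|y [hy yE]] := @lift_rows p 1%N (fun T w => w *m gdiff F 0 = x T).
    move=> T; apply/(gaug_exact (g := F)); move/ffunP/(_ T): x0; rewrite !ffunE => nf0.
    have <- : edge_proj e (0 : S) = 0 by exact: raddf0.
    apply/nf_eq; rewrite // nf0 nf_id // => m _; exact: mcoeff0.
  exists y; split=> //; apply/ffunP=> T; rewrite ffunE.
  have [Tp|Tp] := eqVneq #|T| p; last by rewrite !(inKF_out _ Tp) ?mul0mx.
  by have [w wE ->] := yE T Tp; rewrite rowpart_mul wE (rowpart_id T hx).
- move=> p a [ha aJ].
  have [|y [hy yE]] := @lift_rows p 0%N (fun T w =>
      edge_proj e ((w *m gaug F) 0 0) = edge_proj e (a T)).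
    by move=> T; apply: gaug_onto.
  exists y; split=> //; apply/ffunP=> T; rewrite ffunE; apply/mpolyP=> m.
  have [Tp|Tp] := eqVneq #|T| p; last first.
    rewrite (inKF_out hy Tp) mul0mx mxE coef_pfilter mcoeff0; case: ifP => _.
      by apply/esym/eqP; apply: contraNT Tp => /ha[-> _].
    by apply/esym/eqP; apply: contraNT Tp => /ha[-> _].
  have [w /nf_eq wE ->] := yE T Tp; rewrite rowpart_aug coef_pfilter.
  case: ifPn => [Jm|/negPn/aJ->//]; rewrite coef_pfilter.
  have /mpolyP/(_ m) := wE e_irr; rewrite !coef_pfilter Jm => ->.
  case: ifPn => // ne; apply/esym/eqP; apply: contraNT ne => /ha[_ <-].
  by rewrite addn0.
Qed.

Lemma dK_in q p (x : KF p.+1 q) : inKF x -> inKF (dK x).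
Proof.
move=> hx k T m; rewrite ffunE mxE => nz.
exact: (koszul_graded (hx k)) nz.
Qed.

Lemma augK_in q (x : KF 0 q) : inKF x -> inFK (augK x).
Proof. by move=> hx k; rewrite mxE => /hx[]; rewrite cards0 mdeg0 !add0n. Qed.

Lemma cols_exact : exact_rows (X := fun q p => KF p q)
  (fun q p => @inKF p q) inFK dK augK.
Proof.
split.
- move=> q p x y; apply/ffunP=> T; rewrite !ffunE; apply/rowP=> k.
  rewrite !mxE -koszulB; apply: eq_koszul => t _; rewrite !ffunE !mxE //.
- by move=> q x y; apply/rowP=> k; rewrite !mxE !ffunE mxE mxE mcoeffB.
- exact: dK_in.
- exact: augK_in.
- move=> q p x; apply/ffunP=> T; rewrite !ffunE; apply/rowP=> k; rewrite !mxE.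
  rewrite -[RHS](koszulK (fun T' => x T' 0 k) T); apply: eq_koszul => t _.
  by rewrite ffunE mxE.
- move=> q x; apply/rowP=> k; rewrite !mxE ffunE mxE.
  apply/eqP; apply: contraT => /koszul_neq0[t [_]].
  by rewrite mnm0E.
- move=> q p x hx x0.
  have /boolp.choice[g gP] : forall k : 'I_(grank F q), exists b : {set 'I_n} -> S,
      graded p.+2 j (gshift k) b /\ forall T, koszul b T = x T 0 k.
    move=> k; have [||b hb] := koszul_exact (hx k); last by exists b.
      by move=> T; move/ffunP/(_ T)/rowP/(_ k): x0; rewrite !ffunE !mxE.
    by apply/eqP; apply: contraT => /hx[]; rewrite cards0.
  exists [ffun T => \row_k g k T]; split.
    by move=> k T m; rewrite ffunE mxE; apply: (gP k).1.
  apply/ffunP=> T; rewrite ffunE; apply/rowP=> k; rewrite mxE -(gP k).2.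
  by apply: eq_koszul => t _; rewrite ffunE mxE.
- move=> q x hx x0.
  have /boolp.choice[g gP] : forall k : 'I_(grank F q), exists b : {set 'I_n} -> S,
      graded 1 j (gshift k) b /\ forall T, koszul b T = x T 0 k.
    move=> k; have [||b hb] := koszul_exact (hx k); last by exists b.
      move=> T; apply/mpolyP=> m; rewrite mcoeff0; apply/eqP; apply: contraT.
      move=> /koszul_neq0[t [tT _ /hx[]]].
      by rewrite cardsU1 tT.
    by move/rowP/(_ k): x0; rewrite !mxE.
  exists [ffun T => \row_k g k T]; split.
    by move=> k T m; rewrite ffunE mxE; apply: (gP k).1.
  apply/ffunP=> T; rewrite ffunE; apply/rowP=> k; rewrite mxE -(gP k).2.
  by apply: eq_koszul => t _; rewrite ffunE mxE.
- move=> q u hu; exists [ffun T => if T == set0 then map_mx (@mpolyC n K) u else 0].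
  split.
    move=> k T m; rewrite ffunE.
    case: (eqVneq T set0) => [->|_]; rewrite mxE ?mcoeff0 ?eqxx //.
    rewrite mcoeffC; case: (eqVneq m 0%MM) => [->|_]; last by rewrite mulr0 eqxx.
    by rewrite mulr1 cards0 mdeg0 => /hu.
  by apply/rowP=> k; rewrite mxE ffunE eqxx mxE mcoeffC eqxx mulr1.
Qed.

Lemma dK_dF p q (x : KF p.+1 q.+1) : dK (dF x) = dF (dK x).
Proof.
apply/ffunP=> T; rewrite !ffunE; apply/rowP=> l; rewrite !mxE.
transitivity (koszul (fun T' => \sum_k x T' 0 k * gdiff F q k l) T).
  by apply: eq_koszul => t _; rewrite ffunE mxE.
by rewrite koszul_sum; apply: eq_bigr => k _; rewrite mxE.
Qed.

Lemma augF_dK p (x : KF p.+1 0) : augF (dK x) = dKQ (augF x).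
Proof.
apply/ffunP=> T; rewrite !ffunE; apply/mpolyP=> m; rewrite !coef_pfilter.
case: ifPn => // Jm; rewrite mxE.
transitivity (koszul (fun T' => (x T' *m gaug F) 0 0) T)@_m; last first.
  rewrite -(koszul_nf _ _ Jm); congr (mcoeff m _).
  by apply: eq_koszul => t _; rewrite ffunE.
congr (mcoeff m _).
transitivity (koszul (fun T' => \sum_k x T' 0 k * gaug F k 0) T).
  by rewrite koszul_sum; apply: eq_bigr => k _; rewrite mxE.
by apply: eq_koszul => t _; rewrite mxE.
Qed.

Lemma augK_dF q (x : KF 0 q.+1) : augK (dF x) = dFK (augK x).
Proof.
apply/rowP=> l; rewrite !mxE ffunE mxE raddf_sum /=.
by apply: eq_bigr => k _; rewrite !mxE rmorphM.
Qed.

(** The double complex is symmetric in its two directions, so [zigzag] applies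
to it and to its transpose. *)
Lemma tor_balanced i : exact_at inKQ dKQ i <-> exact_at inFK dFK i.
Proof.
split.
  exact: (zigzag rows_exact cols_exact inKF_sub dK_dF augF_dK augK_dF).
apply: (zigzag (X := fun q p => KF p q) (dh := dK) (dv := dF) cols_exact rows_exact).
- by move=> q p x y; apply: inKF_sub.
- by move=> q p x; rewrite dK_dF.
- exact: augK_dF.
- exact: augF_dK.
Qed.

Lemma KQ_exactP i : exact_at inKQ dKQ i <->
  forall a : 'X_{1..n}, mdeg a = j -> (i <= #|msup a|)%N ->
    acyclic K (mdfaces J a) (#|msup a| - i).
Proof.
split=> [ex a aj ia f f0|ac c [hc cJ] cyc].
  have [b [hb bJ bG]] := exists_mdparts (K := K) J i j 0
    (fun a' U => if a' == a then f U else 0).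
  have bE U : U \in mdfaces J a -> (#|U| + i)%N = #|msup a| -> mdpart b a U = f U.
    by move=> UF Ui; rewrite bG // ?eqxx ?addn0.
  have [||d [_ dE]] := ex [ffun T => b T].
  - split=> [T m|T m /bJ]; last by rewrite ffunE.
    by rewrite ffunE => /hb.
  - case: i ia f0 {ex} hb bJ bG bE => [//|i] ia f0 hb bJ bG bE /=.
    apply/ffunP=> T; rewrite !ffunE; apply/mpolyP=> m; rewrite mcoeff0 coef_pfilter.
    case: ifPn => // Jm.
    rewrite (@eq_koszul _ _ _ b) => [|t _]; last by rewrite ffunE.
    apply/eqP; apply: contraT => nz; have [Ti mT] := koszul_graded hb nz.
    have fm := mdfaces_coef T Jm; have cm := card_msupD m T.
    move: nz; rewrite coef_mdpart.
    set a' := (m + mset T)%MM in fm cm *; set U := _ :\: T in fm cm *.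
    rewrite mdpart_koszul ?(mdfaces_sub fm) //.
    have [aa|ne] := eqVneq a' a.
      suff -> : delta (mdpart b a') U = 0 by rewrite mulr0 eqxx.
      rewrite aa in fm cm *; rewrite -(f0 U) //; last by lia.
      apply: eq_delta => u uU; apply: bE.
        exact: mdfaces_setD1 (@edge_mnm_up _ e) _ _ _ fm.
      by have := cardsD1 u U; rewrite uU; lia.
    suff -> : delta (mdpart b a') U = 0 by rewrite mulr0 eqxx.
    rewrite /delta big1 // => u uU; rewrite bG; first by rewrite (negbTE ne) mulr0.
    + exact: mdfaces_setD1 (@edge_mnm_up _ e) _ _ _ fm.
    + by have := cardsD1 u U; rewrite uU; lia.
    + by rewrite mdegD mdeg_mset.
  exists (mdpart d a) => U UF Ui; have Ui' : (#|U| + i = #|msup a|)%N by lia.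
  rewrite -(bE _ UF Ui') -mdpart_koszul ?(mdfaces_sub UF) // /mdpart; congr (_ * _).
  move/ffunP/(_ (msup a :\: U)): dE; rewrite !ffunE => <-.
  by rewrite coef_pfilter; case/andP: UF => _ ->.
have [a aj|b [hb bJ bE]] := koszul_solve (@edge_mnm_up _ e) hc.
  rewrite addn0 in aj.
  have [ia|ia] := leqP i #|msup a|; last by exists (fun _ => 0) => U _; lia.
  have [|g gE] := ac a aj ia (mdpart c a); last first.
    by exists g => U UF Ui; apply: gE => //; lia.
  move=> U UF Ui; case: i c hc cJ cyc ia Ui {ac} => [|i] c hc cJ cyc ia Ui /=.
    have := subset_leq_card (mdfaces_sub UF); lia.
  rewrite -mdpart_koszul ?(mdfaces_sub UF) // /mdpart.
  move/ffunP/(_ (msup a :\: U)): cyc; rewrite !ffunE.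
  move=> /mpolyP/(_ (a - mset (msup a :\: U))%MM).
  by rewrite coef_pfilter mcoeff0; case/andP: UF => _ -> ->; rewrite mulr0.
exists [ffun T => b T]; split.
  by split=> [T m|T m /bJ]; rewrite ffunE // => /hb.
apply/ffunP=> T; rewrite ffunE; apply/mpolyP=> m; rewrite coef_pfilter.
case: ifPn => [Jm|/negPn/cJ->//]; rewrite bE //; congr (mcoeff m _).
by apply: eq_koszul => t _; rewrite ffunE.
Qed.

Lemma mdeg_squarefree (a : 'X_{1..n}) : (forall i, (a i <= 1)%N) -> mdeg a = #|msup a|.
Proof.
move=> a1; rewrite -mdeg_mset; congr mdeg; apply/mnmP=> i.
by rewrite msetE inE; case: (a i) (a1 i) => [|[|]].
Qed.

Lemma msup_mset (U : {set 'I_n}) : msup (mset U) = U.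
Proof. by apply/setP=> i; rewrite inE msetE; case: (i \in U). Qed.

Lemma KQ_nonexactP i : ~ exact_at inKQ dKQ i <->
  exists s : {set 'I_n}, [/\ #|s| = j, (i <= j)%N & nonvan K e s (j - i)].
Proof.
rewrite KQ_exactP; split=> [nac|[s [sj ij /negP ns]] ac]; last first.
  have m1 x : (mset s x <= 1)%N by rewrite msetE; case: (x \in s).
  apply: ns; apply/boolp.asboolP.
  have := ac (mset s); rewrite msup_mset mdeg_mset sj => /(_ erefl ij).
  by apply: eq_acyclic => U; rewrite edge_mdfaces // msup_mset.
apply: boolp.contrapT => nex; apply: nac => a aj ia.
have [a1|/forallPn[x]] := boolP [forall x, a x <= 1]%N; last first.
  by rewrite -ltnNge => ax; apply: edge_mdfaces_acyclic ax.
have {}a1 x : (a x <= 1)%N by move/forallP: a1.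
have sj : #|msup a| = j by rewrite -mdeg_squarefree.
apply: (@eq_acyclic K n (faces e (msup a))) => [U|]; first by rewrite edge_mdfaces.
apply/nonvanPn; apply/negP => ns; apply: nex; exists (msup a).
by rewrite -sj.
Qed.

Lemma sub_tor_degP q (u : FK q) : (u <= tor_deg F q j)%MS <-> inFK u.
Proof.
split=> [/submxP[w ->] k|hu].
  rewrite mul_mx_diag !mxE; case: (eqVneq (gshift k) j) => // _.
  by rewrite mulr0 eqxx.
apply/submxP; exists u; apply/rowP=> k; rewrite mul_mx_diag !mxE.
case: (eqVneq (gshift k) j) => [_|ne]; rewrite ?mulr1 // mulr0.
by apply/eqP; apply: contraNT ne => /hu ->.
Qed.

(** Constants lift to [KF], where the differential squares to zero. *)
Lemma tor_diffK q (u : FK q.+2) : dFK (dFK u) = 0.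
Proof.
have := row_dd rows_exact (p := 0) (q := q) [ffun T => map_mx (@mpolyC n K) u].
have uE : augK ([ffun T => map_mx (@mpolyC n K) u] : KF 0 q.+2) = u.
  by apply/rowP=> k; rewrite mxE ffunE mxE mcoeffC eqxx mulr1.
move/(congr1 (@augK _)); rewrite !augK_dF uE => ->.
by apply/rowP=> k; rewrite !mxE ffunE mxE mcoeff0.
Qed.

Lemma dFK_in q (u : FK q.+1) : inFK u -> inFK (dFK u).
Proof.
move=> hu; have [x [hx xE]] := row_onto cols_exact hu.
by rewrite -xE -augK_dF; apply: augK_in; apply: dF_in.
Qed.

Lemma betti_eq0 i : betti F i j = 0%N <-> exact_at inFK dFK i.
Proof.
have cycP (u : FK i) : (u <= tor_cycles F i j)%MS <-> inFK u /\ is_cycle dFK u.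
  rewrite -sub_tor_degP; case: i u => [|i] u /=; first by split=> [|[]].
  rewrite sub_capmx; split=> [/andP[-> /sub_kermxP]|[-> u0]] //.
  by apply/andP; split=> //; apply/sub_kermxP.
have bdP (u : FK i) : (u <= tor_boundaries F i j)%MS <->
    exists b, inFK b /\ dFK b = u.
  split=> [/submxP[w ->]|[b [/sub_tor_degP/submxP[w ->] <-]]].
    exists (w *m tor_deg F i.+1 j); rewrite /dFK mulmxA; split=> //.
    by apply/sub_tor_degP; apply: submxMl.
  by apply/submxP; exists w; rewrite /dFK mulmxA.
have bc : (tor_boundaries F i j <= tor_cycles F i j)%MS.
  apply/row_subP=> k; apply/cycP.
  have /bdP[b [hb <-]] := row_sub k (tor_boundaries F i j).
  split; first exact: dFK_in.
  by case: {cycP bdP k} i b hb => [//|i] b hb /=; apply: tor_diffK.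
split=> [/eqP b0 u hu cu|ex].
  apply/bdP; have /cycP uc := conj hu cu; apply: submx_trans uc _.
  by move: b0; rewrite /betti subn_eq0 => le; rewrite -(geq_leqif (mxrank_leqif_sup bc)).
apply/eqP; rewrite subn_eq0; apply: mxrankS; apply/row_subP=> k.
have /cycP[hu cu] := row_sub k (tor_cycles F i j).
by apply/bdP; apply: ex.
Qed.

Lemma bettiP i : betti F i j != 0%N <->
  exists s : {set 'I_n}, [/\ #|s| = j, (i <= j)%N & nonvan K e s (j - i)].
Proof.
rewrite -KQ_nonexactP tor_balanced -betti_eq0; split; [by move/eqP|by move/eqP].
Qed.

End Hochster.

Lemma reach_max_shift (K : fieldType) (n : nat) (e : rel 'I_n)
    (e_irr : irreflexive e) (F : graded_free_res K e) (s : {set 'I_n}) i h :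
  reach K e s i h -> (i + h <= max_shift F i)%N.
Proof.
move=> [t [k [_ hk tk tE]]]; apply: (@leq_trans (i + k)); first by rewrite leq_add2l.
apply: max_shift_ub; apply/(bettiP e_irr F); exists t; split=> //.
  exact: leq_addr.
by rewrite addKn.
Qed.

Theorem corollary3p5 (K : fieldType) (n : nat) (e : rel 'I_n)
    (e_sym : ssrbool.symmetric e) (e_irr : irreflexive e)
    (F : graded_free_res K e) (p : nat)
    (p_pd : is_proj_dim (edge_ring K e) p) (a b : nat)
    (b_le4 : (b <= 4)%N) (ab_le_pd : (a + b <= p)%N) :
  (max_shift F (a + b) <= max_shift F a + max_shift F b)%N.
Proof.
apply/bigmax_leqP => k /(bettiP e_irr F)[s [sj abj sh]].
have [|r rb ra] := nonvan_subadd4 e_sym e_irr (a := a) (b := b) sh _ b_le4.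
  by rewrite sj subnKC.
have := reach_max_shift e_irr F rb.
have := reach_max_shift e_irr F ra.
move: abj; lia.
Qed.
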